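(* Let $T>0$, let $n,d\ge1$ be integers, let $f\in C_b^2(\mathbb{R}^n;\mathcal{L}(\mathbb{R}^d;\mathbb{R}^n))$, and let $q\in[1,2)$ and $p\in[q,\infty)$ satisfy $1/p+1/q>1$. Let $(Y,K)$ and $(\tilde Y,\tilde K)$ be the unique solutions of the reflected Young differential equation $$Y_t=y+\int_0^t f(Y_s)\,\mathrm{d}A_s+X_t+K_t,\qquad t\in[0,T],$$ given the data $(y,A,X,L)$ and $(\tilde y,\tilde A,\tilde X,\tilde L)$ respectively, where $y,\tilde y\in\mathbb{R}^n$, $A,\tilde A\in D^q([0,T];\mathbb{R}^d)$, $X,\tilde X\in D^p([0,T];\mathbb{R}^n)$ and $L,\tilde L\in D^p([0,T];\mathbb{R}^n)$, with $y\ge L_0$ and $\tilde y\ge\tilde L_0$ (componentwise). Suppose that the norms $\|A\|_{q,[0,T]}$, $\|\tilde A\|_{q,[0,T]}$, $\|X\|_{p,[0,T]}$, $\|\tilde X\|_{p,[0,T]}$, $\|L\|_{p,[0,T]}$ and $\|\tilde L\|_{p,[0,T]}$ are all bounded by a given constant $M>0$. Then $$\|Y-\tilde Y\|_{p,[0,T]}+\|K-\tilde K\|_{p,[0,T]}\le C_{M,f}\Big(|y-\tilde y|+\|A-\tilde A\|_{q,[0,T]}+\|X-\tilde X\|_{p,[0,T]}+|L_0-\tilde L_0|+\|L-\tilde L\|_{p,[0,T]}\Big)$$ for some constant $C_{M,f}$ depending on $M$, $\|f\|_{C_b^2}$, $p$, $q$ and $n$.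
   Context: For $r\ge1$, $D^r([0,T];\mathbb{R}^m)$ denotes the space of càdlàg (right-continuous with left limits) paths $Z:[0,T]\to\mathbb{R}^m$ with finite $r$-variation $\|Z\|_{r,[0,T]}<\infty$, where $\|Z\|_{r,[s,t]}:=\big(\sup_{\mathcal{P}}\sum_{[u,v]\in\mathcal{P}}|Z_v-Z_u|^r\big)^{1/r}$, the supremum being over all finite partitions $\mathcal{P}$ of $[s,t]$, and $|\cdot|$ is the Euclidean norm. $\mathcal{L}(\mathbb{R}^d;\mathbb{R}^n)$ is the space of linear maps $\mathbb{R}^d\to\mathbb{R}^n$. $C_b^k(\mathbb{R}^n;\mathcal{L}(\mathbb{R}^d;\mathbb{R}^n))$ is the space of $k$-times Fréchet differentiable functions which, together with all derivatives up to order $k$, are continuous and bounded, with norm $\|f\|_{C_b^k}:=\|f\|_\infty+\|\mathrm{D}f\|_\infty+\dots+\|\mathrm{D}^kf\|_\infty$. Young integral: for a càdlàg path $H$ of finite $p$-variation with values in $\mathcal{L}(\mathbb{R}^d;\mathbb{R}^n)$ and $A\in D^q([0,T];\mathbb{R}^d)$ with $1/p+1/q>1$, $\int_s^tH_r\,\mathrm{d}A_r:=\lim_{|\mathcal{P}|\to0}\sum_{[u,v]\in\mathcal{P}}H_u(A_v-A_u)$ (left-point Riemann sums, limit over partitions of $[s,t]$ with mesh tending to $0$). Solution: a pair $(Y,K)$ is a solution of the reflected Young differential equation with data $(y,A,X,L)$ if $Y,K\in D^p([0,T];\mathbb{R}^n)$ satisfy the displayed equation for all $t\in[0,T]$ and,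 for every $i=1,\dots,n$: (a) $Y^i_t\ge L^i_t$ for all $t\in[0,T]$; (b) $K^i:[0,T]\to\mathbb{R}$ is a non-decreasing function with $K^i_0=0$ and $\int_0^t(Y^i_s-L^i_s)\,\mathrm{d}K^i_s=0$ for all $t\in[0,T]$, where this last integral is a Lebesgue–Stieltjes integral. Convention: constants may in addition depend on the dimensions of the underlying spaces.
   Formalization: The formal theorem assumes X_0 = X̃_0 (e.g. both 0); otherwise the estimate fails, since the right-hand side does not control |X_0 − X̃_0|: y = ỹ = 0, X = 0, X̃ = 1, A = Ã = t, L = L̃ very low, f = sin. *)

(* Defs.v *)
From HB Require Import structures.
From mathcomp Require Import all_boot all_order all_algebra.
From mathcomp Require Import all_classical all_reals all_analysis.

Set Implicit Arguments.
Unset Strict Implicit.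
Unset Printing Implicit Defensive.

Import Order.TTheory GRing.Theory Num.Theory.
Import numFieldNormedType.Exports.

Local Open Scope classical_set_scope.
Local Open Scope ring_scope.

(* Conventions.
   - Vectors of R^n are row vectors 'rV[R]_n; a linear map R^d -> R^n is the
     matrix B : 'M[R]_(d, n) acting by v |-> v *m B.
   - The topology of 'M[R]_(m, n) is the library's; its built-in norm `|_| is
     the max norm, so the Euclidean and operator norms are defined here.
   - A path on [0, T] is a function R -> 'rV[R]_n of which only the values on
     [0, T] are ever used. *)

Section Norms.
Context {R : realType}.

Definition eucl n (v : 'rV[R]_n) : R := Num.sqrt (\sum_(i < n) v 0 i ^+ 2).

(* The supremum is over a bounded set whenever g is linear and N is a norm. *)
Definition opnorm n (W : Type) (N : W -> R) (g : 'rV[R]_n -> W) : R :=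
  sup [set N (g v) | v in [set v | eucl v <= 1]].

Definition mx_opnorm d n (B : 'M[R]_(d, n)) : R :=
  opnorm (@eucl n) (fun v => v *m B).

(* L(R^k; 'M_(a, b)) is encoded by 'M_(k, a * b): the matrix B stands for
   h |-> vec_mx (h *m B). *)
Definition lin_opnorm k a b (N : 'M[R]_(a, b) -> R) (B : 'M[R]_(k, a * b)) : R :=
  opnorm N (fun h => vec_mx (h *m B)).

(* The Frechet derivative as a map into L(R^k; 'M_(a, b)), in the encoding
   above: vec_mx (h *m frechet g x) = 'd g x h. *)
Definition frechet k a b (g : 'rV[R]_k -> 'M[R]_(a, b)) (x : 'rV[R]_k) :
    'M[R]_(k, a * b) :=
  lin1_mx (fun h => mxvec ('d g x h)).

(* C_b^j for maps R^k -> 'M_(a, b), where N is the norm on 'M_(a, b). *)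
Fixpoint is_Cb (j : nat) k a b (N : 'M[R]_(a, b) -> R)
    (g : 'rV[R]_k -> 'M[R]_(a, b)) {struct j} : Prop :=
  [/\ continuous g, has_ubound (range (fun x => N (g x))) &
    if j is j'.+1 then
      (forall x, differentiable g x) /\ is_Cb j' (lin_opnorm N) (frechet g)
    else True].

Fixpoint Cb_norm (j : nat) k a b (N : 'M[R]_(a, b) -> R)
    (g : 'rV[R]_k -> 'M[R]_(a, b)) {struct j} : R :=
  sup (range (fun x => N (g x))) +
    (if j is j'.+1 then Cb_norm j' (lin_opnorm N) (frechet g) else 0).

End Norms.

Section Paths.
Context {R : realType}.
Implicit Types (r s t T : R) (l : seq R).

(* itv_partition s t l is the partition s < l_0 < ... < l_(size l - 1) = t;
   its points, in order, are part_pt s t l k for k <= size l. *)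
Definition part_pt s t l (k : nat) : R := nth t (s :: l) k.

Definition rvar_sum n r s t (Z : R -> 'rV[R]_n) l : R :=
  \sum_(0 <= k < size l)
    eucl (Z (part_pt s t l k.+1) - Z (part_pt s t l k)) `^ r.

Definition rvar n r s t (Z : R -> 'rV[R]_n) : \bar R :=
  (ereal_sup [set (rvar_sum r s t Z l)%:E | l in itv_partition s t] `^ r^-1)%E.

Definition cadlag n T (Z : R -> 'rV[R]_n) : Prop :=
  (forall t, 0 <= t < T -> Z x @[x --> t^'+] --> Z t) /\
  (forall t, 0 < t <= T -> cvg (Z x @[x --> t^'-])).

Definition Dspace n r T (Z : R -> 'rV[R]_n) : Prop :=
  cadlag T Z /\ (rvar r 0%R T Z < +oo)%E.

Definition riemann_sum d n s t (H : R -> 'M[R]_(d, n)) (A : R -> 'rV[R]_d) l :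
    'rV[R]_n :=
  \sum_(0 <= k < size l)
    (A (part_pt s t l k.+1) - A (part_pt s t l k)) *m H (part_pt s t l k).

(* I is the limit of the left-point Riemann sums as the mesh tends to 0. *)
Definition is_young_integral d n s t (H : R -> 'M[R]_(d, n))
    (A : R -> 'rV[R]_d) (I : 'rV[R]_n) : Prop :=
  forall e : R, 0 < e -> exists2 delta : R, 0 < delta &
    forall l, itv_partition s t l ->
      (forall k, (k < size l)%N ->
        part_pt s t l k.+1 - part_pt s t l k < delta) ->
      eucl (riemann_sum s t H A l - I) < e.

(* A function k, non-decreasing and right-continuous on [0, T], induces a
   Stieltjes measure on ]0, T] through any extension F of k to a cumulative
   function on the line: the measure of a subset of ]0, T] depends only on the
   values of F on [0, T]. There is no mass at 0, since K_0 = 0. *)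
Definition stieltjes_integral0 T (g k : R -> R) : Prop :=
  exists2 F : cumulative R R, {in `[0, T], F =1 k} &
    forall t, 0 <= t <= T ->
      (\int[lebesgue_stieltjes_measure F]_(s in `]0%R, t]) (g s)%:E = 0)%E.

Definition is_reflected_solution n d (p T : R)
    (f : 'rV[R]_n -> 'M[R]_(d, n)) (y : 'rV[R]_n) (A : R -> 'rV[R]_d)
    (X L Y K : R -> 'rV[R]_n) : Prop :=
  [/\ Dspace p T Y, Dspace p T K,
      forall t, 0 <= t <= T ->
        exists2 I, is_young_integral 0 t (f \o Y) A I & Y t = y + I + X t + K t &
      forall i : 'I_n,
        [/\ forall t, 0 <= t <= T -> L t 0 i <= Y t 0 i,
            {in `[0, T] &, {homo (fun t => K t 0 i) : s t / s <= t}},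
            K 0 0 i = 0 &
            stieltjes_integral0 T (fun s => Y s 0 i - L s 0 i)
              (fun s => K s 0 i)]].

End Paths.

Arguments eucl {R n} v%_R.
Arguments rvar {R n} r%_R s%_R t%_R Z%_R.

(* Main.v *)
From HB Require Import structures.
Require Import Defs.
From mathcomp Require Import all_boot all_order all_algebra.
From mathcomp Require Import all_classical all_reals all_analysis.
From mathcomp Require Import ring lra.

(** Write [Y = u + K] with [u = y + J + X], where [J] is the Young integral. All paths
    are treated component by component, and constants are not optimised.

    Reflection. A component of [K] increases only at times when [Y] is arbitrarily
    close to [L], that is, when [K] is close to the level [x = L - u]
    ([stieltjes_flat_off]), and it never falls below this level. Given two solutions,
    whenever [K] gains on [K'] it touches [x] whereas [K'] still lies above [x'], so that
    [K - K'] is then at most [x - x']; the same holds with the roles exchanged. The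
    successive maxima of [K - K'] along a partition therefore lie below, and the minima
    above, values of [x - x'] at interlaced times, and the [p]-variation of [K - K']
    is bounded by that of [x - x'] and the initial gap ([reflection_bvar]).

    Integration. Left-point Riemann sums are estimated by removing partition points
    one by one ([young_estimate]). The last value of the integrand does not occur in
    them, so it suffices to control the integrand before the right end. With the
    mean value estimate [Cb2_increment] for increments of [f Y - f Y'] and the
    reflection estimate, this gives [difference_step]: if [v] bounds the variation of
    [Y - Y'] on a half-open interval from [a] to [b], then on the closed interval it
    is at most [C0 * (|Y a - Y' a| + B) + C0 * v * om `^ q^-1], where [om] is the growth of a
    control of [A] between [a] and [b] and [B] is the distance of the data. The
    analogue for [Y] alone is [apriori_step].

    Propagation. If [om] is small before [b], the term in [v] is absorbed there; the
    end [b], at which [A] may jump, is then added by one more use of the same estimate.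
    The total control is bounded in terms of [M], so the number of intervals needed to
    cover the whole is bounded as well, and right-continuity allows to start afresh
    after each of them ([propagation_bound]). This is applied
    twice: to [Y], which bounds the variation of both solutions, and to [Y - Y']. *)

Import Order.TTheory GRing.Theory Num.Theory.
Import numFieldNormedType.Exports.
Local Open Scope ring_scope.
Set Implicit Arguments.
Unset Strict Implicit.
Unset Printing Implicit Defensive.

(** * Real powers *)

Section Powers.
Context {R : realType}.
Implicit Types p x y z : R.

Lemma le_powR p x y : 0 <= p -> 0 <= x -> x <= y -> x `^ p <= y `^ p.
Proof.
by move=> p0 x0 xy; apply: ge0_ler_powR => //; rewrite nnegrE// (le_trans x0).
Qed.

Lemma powR_le_inv p x y : 0 < p -> 0 <= x -> 0 <= y ->
  x `^ p <= y `^ p -> x <= y.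
Proof.
move=> p0 x0 y0; apply: contraTT; rewrite -!ltNge => yx.
by apply: gt0_ltr_powR => //; rewrite nnegrE.
Qed.

Lemma powRK p x : p != 0 -> 0 <= x -> (x `^ p) `^ p^-1 = x.
Proof. by move=> p0 x0; rewrite -powRrM divff// powRr1. Qed.

Lemma powRVK p x : p != 0 -> 0 <= x -> (x `^ p^-1) `^ p = x.
Proof. by move=> p0 x0; rewrite -powRrM mulVf// powRr1. Qed.

Lemma powR_superadd p x y : 1 <= p -> 0 <= x -> 0 <= y ->
  x `^ p + y `^ p <= (x + y) `^ p.
Proof.
move=> p1 x0 y0; have p0 : 0 < p by apply: lt_le_trans p1.
rewrite -!(@mulr_powRB1 _ _ p)// ?addr_ge0// mulrDl.
by apply: lerD; apply: ler_wpM2l => //; apply: le_powR;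
  rewrite ?subr_ge0// ?lerDl ?lerDr.
Qed.

Lemma powR_natr_ge p (n : nat) : 1 <= p -> n%:R <= n%:R `^ p :> R.
Proof.
by move=> p1; case: n => [|n]; [exact: powR_ge0 | rewrite le1r_powR// ler1n].
Qed.

Lemma powR_sum_le (I : finType) p (x : I -> R) : 1 <= p ->
  (forall i, 0 <= x i) ->
  (\sum_i x i) `^ p <= #|I|%:R `^ p * \sum_i x i `^ p.
Proof.
move=> p1 x0; have p0 : 0 < p by apply: lt_le_trans p1.
have pn0 : p != 0 by rewrite gt_eqF.
set S := \sum_i x i `^ p; have S0 : 0 <= S by apply: sumr_ge0 => i _; exact: powR_ge0.
have xS i : x i <= S `^ p^-1.
  apply: (@powR_le_inv p) => //; rewrite ?powR_ge0// powRVK//.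
  by rewrite /S (bigD1 i)//= lerDl sumr_ge0// => j _; exact: powR_ge0.
rewrite -[X in _ * X](@powRVK p S)// -powRM ?powR_ge0//; apply: le_powR.
- exact: ltW.
- exact: sumr_ge0.
- by rewrite mulr_natl -sumr_const; apply: ler_sum => i _; exact: xS.
Qed.

End Powers.

(** * Sums along chains of times *)

Section ChainSums.
Context {R : realType}.
Implicit Types (phi psi : R -> R -> R) (s t : R) (l : seq R) (I : interval R).

Fixpoint psum phi s l : R :=
  if l is t :: l' then phi s t + psum phi t l' else 0.

(** Chains increase weakly and need not reach the ends of the interval. They can
    thus be cut, joined and extended freely, and half-open intervals make sense. *)
Definition chain I s l := path <=%R s l && all (fun x => x \in I) (s :: l).

Lemma psum_cat phi s l l' :
  psum phi s (l ++ l') = psum phi s l + psum phi (last s l) l'.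
Proof. by elim: l s => [|t l IH] s /=; rewrite ?add0r// IH addrA. Qed.

Lemma chain_cons I s t l :
  chain I s (t :: l) = [&& s <= t, s \in I & chain I t l].
Proof.
rewrite /chain /=; case: (s <= t); case: (s \in I) => //=.
by rewrite andbF.
Qed.

Lemma chain_cat I s l l' :
  chain I s (l ++ l') = chain I s l && chain I (last s l) l'.
Proof.
elim: l s => [|t l IH] s; last by rewrite cat_cons !chain_cons IH /= -!andbA.
rewrite /= [chain I s [::]]/chain /= andbT; case: (boolP (s \in I)) => //= sI.
by rewrite /chain /= (negbTE sI) andbF.
Qed.

Lemma le_psum I phi psi s l :
  (forall x y, x \in I -> y \in I -> x <= y -> phi x y <= psi x y) ->
  chain I s l -> psum phi s l <= psum psi s l.
Proof.
move=> H; elim: l s => [//|t l IH] s; rewrite chain_cons => /and3P[st sI tl] /=.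
apply: lerD; last exact: IH.
by apply: H => //; case/andP: tl => _ /andP[].
Qed.

Lemma psum_ge0 I phi s l :
  (forall x y, x \in I -> y \in I -> x <= y -> 0 <= phi x y) ->
  chain I s l -> 0 <= psum phi s l.
Proof.
move=> H c; suff <- : psum (fun _ _ => 0) s l = 0 by apply: le_psum c.
by elim: l s {c} => [//|t l IH] s /=; rewrite IH addr0.
Qed.

Lemma psum_sum (K : finType) (phi : K -> R -> R -> R) s l :
  psum (fun x y => \sum_k phi k x y) s l = \sum_k psum (phi k) s l.
Proof.
elim: l s => [|t l IH] s /=; first by rewrite big1.
by rewrite IH -big_split.
Qed.

Lemma psumZ (c : R) phi s l :
  psum (fun x y => c * phi x y) s l = c * psum phi s l.
Proof. by elim: l s => [|t l IH] s /=; rewrite ?mulr0// IH mulrDr. Qed.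

Lemma psum_telescope (W : R -> R) s l :
  psum (fun x y => W y - W x) s l = W (last s l) - W s.
Proof. elim: l s => [|t l IH] s /=; rewrite ?subrr// IH; ring. Qed.

Lemma chain_last I s l : chain I s l -> s <= last s l.
Proof.
elim: l s => [//|t l IH] s; rewrite chain_cons => /and3P[st _ /IH].
exact: le_trans.
Qed.

Lemma chain_mem I s l x : chain I s l -> x \in s :: l -> x \in I.
Proof. by move=> /andP[_ /allP H] /H. Qed.

Lemma chain_mem_last I s l : chain I s l -> last s l \in I.
Proof. by move=> c; apply: (chain_mem c); rewrite mem_last. Qed.

Lemma chain_sub I (J : interval R) s l : {subset I <= J} -> chain I s l -> chain J s l.
Proof.
by move=> IJ /andP[ps /allP H]; rewrite /chain ps; apply/allP => x /H /IJ.
Qed.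

Lemma chain_bounds I s l x : chain I s l -> x \in s :: l -> s <= x <= last s l.
Proof.
elim: l s x => [|t l IH] s x; first by rewrite inE => _ /eqP ->; rewrite /= !lexx.
rewrite chain_cons => /and3P[st _ c]; rewrite inE => /predU1P[->|xl].
  by rewrite lexx /= (le_trans st)// (chain_last c).
by have /andP[tx ->] := IH _ _ c xl; rewrite (le_trans st).
Qed.

(** Repeated times contribute nothing, so a weakly increasing chain can be
    replaced by a strictly increasing one, as demanded of a partition. *)
Lemma chain_strict phi s l : (forall x, phi x x = 0) -> path <=%R s l ->
  exists l', [/\ path <%R s l', last s l' = last s l & psum phi s l' = psum phi s l].
Proof.
move=> phi0; elim: l s => [|t l IH] s /=; first by exists [::].
move=> /andP[]; rewrite le_eqVlt => /predU1P[<- /IH[l' [? ? ?]]|st /IH[l' [? ? e]]].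
  by exists l'; split => //; rewrite phi0 add0r.
by exists (t :: l'); split => //=; rewrite ?st// e.
Qed.

End ChainSums.

(** * Variation of scalar paths *)

Section BoundedVariation.
Context {R : realType}.
Implicit Types (p v : R) (s t : R) (l : seq R) (I : interval R) (Z : R -> R).

Definition incr p Z s t : R := `|Z t - Z s| `^ p.

Definition bvar p I Z v := forall s l, chain I s l -> psum (incr p Z) s l <= v `^ p.

Lemma incrxx p Z s : p != 0 -> incr p Z s s = 0.
Proof. by move=> p0; rewrite /incr subrr normr0 powR0. Qed.

Lemma bvar_sub p I J Z v : {subset I <= J} -> bvar p J Z v -> bvar p I Z v.
Proof. by move=> IJ H s l /(chain_sub IJ)/H. Qed.

Lemma bvar_le p I Z v w : 0 <= p -> 0 <= v -> v <= w -> bvar p I Z v -> bvar p I Z w.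
Proof. by move=> p0 v0 vw H s l /H/le_trans; apply; exact: le_powR. Qed.

Lemma bvar_incr p I Z v s t : 0 < p -> 0 <= v -> bvar p I Z v ->
  s \in I -> t \in I -> `|Z t - Z s| <= v.
Proof.
move=> p0 v0; wlog st : s t / s <= t => [W|].
  by have [|/ltW] := leP s t; [exact: W|rewrite distrC => h *; exact: W].
move=> H sI tI; apply: (@powR_le_inv _ p) => //.
have := H s [:: t]; rewrite /= addr0; apply.
by rewrite chain_cons st sI /chain /= tI.
Qed.

Lemma bvar_dom (K : finType) (h : K -> R -> R) p I Z (c v : R) :
  1 <= p -> 0 <= c -> 0 <= v ->
  (forall s t, s \in I -> t \in I -> s <= t ->
     `|Z t - Z s| <= c * \sum_k `|h k t - h k s|) ->
  (forall k, bvar p I (h k) v) ->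
  bvar p I Z (c * #|K|%:R ^+ 2 * v).
Proof.
move=> p1 c0 v0 Zh hv s l cl.
have p0 : 0 <= p by apply: le_trans p1.
have S0 x y : 0 <= \sum_k `|h k y - h k x| by apply: sumr_ge0.
apply: (@le_trans _ _ (psum (fun x y => (c `^ p * #|K|%:R `^ p) *
    \sum_k incr p (h k) x y) s l)).
  apply: le_psum cl => x y xI yI xy; rewrite -mulrA.
  apply: (@le_trans _ _ ((c * \sum_k `|h k y - h k x|) `^ p)).
    by apply: le_powR => //; exact: Zh.
  by rewrite powRM//; apply: ler_wpM2l; [exact: powR_ge0|exact: powR_sum_le].
rewrite psumZ psum_sum expr2 !powRM ?mulr_ge0// !mulrA -!mulrA.
do 2! [apply: ler_wpM2l; first exact: powR_ge0].
apply: (@le_trans _ _ (#|K|%:R * v `^ p)).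
  by rewrite mulr_natl -sumr_const; apply: ler_sum => k _; exact: hv.
by apply: ler_wpM2r; [exact: powR_ge0|exact: powR_natr_ge].
Qed.

Lemma bvar_dom1 p I Z (h : R -> R) (c v : R) : 1 <= p -> 0 <= c -> 0 <= v ->
  (forall s t, s \in I -> t \in I -> s <= t -> `|Z t - Z s| <= c * `|h t - h s|) ->
  bvar p I h v -> bvar p I Z (c * v).
Proof.
move=> p1 c0 v0 Zh hv.
have := @bvar_dom unit (fun=> h) p I Z c v p1 c0 v0.
rewrite card_unit expr1n mulr1; apply => // s t sI tI st.
by rewrite big_const card_unit /= addr0; exact: Zh.
Qed.

Lemma bvar_dom2 p I Z (h h' : R -> R) (v : R) : 1 <= p -> 0 <= v ->
  (forall s t, s \in I -> t \in I -> s <= t ->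
     `|Z t - Z s| <= `|h t - h s| + `|h' t - h' s|) ->
  bvar p I h v -> bvar p I h' v -> bvar p I Z (4 * v).
Proof.
move=> p1 v0 Zh hv hv'.
have := @bvar_dom bool (fun b => if b then h else h') p I Z 1 v p1 ler01 v0.
rewrite card_bool mul1r -natrX; apply => [s t sI tI st|[]//].
by rewrite big_bool mul1r; exact: Zh.
Qed.

(** No single increment exceeds [v], so the excess power [p - q] of each increment is
    at most [v `^ (p - q)]. *)
Lemma bvar_mono_exp p q I Z v : 1 <= q -> q <= p -> 0 <= v ->
  bvar q I Z v -> bvar p I Z v.
Proof.
move=> q1 qp v0 H s l c; have q0 : 0 < q by apply: lt_le_trans q1.
have e (x : R) : 0 <= x -> x `^ p = x `^ q * x `^ (p - q).
  by move=> x0; rewrite -powRD ?(addrC q) ?subrK// gt_eqF// (lt_le_trans q0).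
rewrite (e v)// (le_trans _ (ler_wpM2r (powR_ge0 _ _) (H s l c)))//.
rewrite mulrC -psumZ; apply: le_psum c => x y xI yI xy.
rewrite /incr e// mulrC; apply: ler_wpM2r; first exact: powR_ge0.
by apply: le_powR; rewrite ?subr_ge0//; exact: bvar_incr H _ _.
Qed.

(** The running variation turns a bound on all chain sums into a single
    non-decreasing function whose increments dominate those of the path:
    sums over partitions then telescope. *)
Lemma bvar_control p I Z v : 0 <= v -> bvar p I Z v ->
  exists W : R -> R,
    (forall s t, s \in I -> t \in I -> s <= t -> incr p Z s t <= W t - W s) /\
    (forall t, t \in I -> 0 <= W t <= v `^ p).
Proof.
move=> v0 H.
pose S t : set R := fun x => exists s l, [/\ chain I s l, last s l <= t & x = psum (incr p Z) s l].
have Sub t : ubound (S t) (v `^ p) by move=> _ [s [l [c _ ->]]]; exact: H.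
have S0 t : t \in I -> S t 0.
  by move=> tI; exists t, [::]; split => //; rewrite /chain /= tI.
have Ssup t : t \in I -> has_sup (S t).
  by move=> tI; split; [exists 0; exact: S0|exists (v `^ p); exact: Sub].
exists (fun t => sup (S t)); split=> [s t sI tI st|t tI]; last first.
  apply/andP; split; first by apply: ub_le_sup; [exact: (Ssup t tI).2|exact: S0].
  by apply: ge_sup; [exact: (Ssup t tI).1|exact: Sub].
rewrite lerBrDl -lerBrDr; apply: ge_sup; first exact: (Ssup s sI).1.
move=> _ [r [l [c ls ->]]]; rewrite lerBrDr.
apply: (@le_trans _ _ (psum (incr p Z) r (l ++ [:: s; t]))).
  rewrite psum_cat /= addr0 lerD2l lerDr; exact: powR_ge0.
apply: ub_le_sup; first exact: (Ssup t tI).2.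
exists r, (l ++ [:: s; t]); split => //; last by rewrite last_cat.
by rewrite chain_cat c !chain_cons ls st sI (chain_mem_last c) /chain /= tI.
Qed.

Lemma bvar_of_control p I Z (W : R -> R) v w : 0 < p -> 0 <= v ->
  (forall s t, s \in I -> t \in I -> s <= t -> incr p Z s t <= W t - W s) ->
  (forall t, t \in I -> w <= W t <= w + v `^ p) -> bvar p I Z v.
Proof.
move=> p0 v0 ZW Wv s l c; apply: (le_trans (le_psum ZW c)).
rewrite psum_telescope.
have /andP[_ h1] := Wv _ (chain_mem_last c).
have /andP[h2 _] := Wv s (chain_mem c (mem_head _ _)).
lra.
Qed.

End BoundedVariation.

(** * The discrete Young inequality *)

Section ZetaBound.
Context {R : realType}.

(** A discrete integral test: [x `^ (- (1 + e))] is at most the integral of this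
    power over the unit interval ending at [x]. The inequality reduces to
    [1 + e / x <= (1 - 1 / x) `^ (- e)], which is convexity of the exponential. *)
Lemma powR_neg_step (e x : R) : 0 < e -> 1 < x ->
  x `^ (- (1 + e)) <= e^-1 * ((x - 1) `^ (- e) - x `^ (- e)).
Proof.
move=> e0 x1; have x0 : 0 < x by apply: lt_trans x1.
have -> : x `^ (- (1 + e)) = x^-1 * x `^ (- e).
  by rewrite opprD powRD ?powR_inv1 ?(ltW x0)// (gt_eqF x0) implybT.
have -> : x - 1 = x * (1 - x^-1) by rewrite mulrBr mulr1 mulfV// gt_eqF.
have y0 : 0 < 1 - x^-1 by rewrite subr_gt0 invf_lt1.
rewrite (powRM _ (ltW x0) (ltW y0)).
have key : 1 + e * x^-1 <= (1 - x^-1) `^ (- e).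
  rewrite /powR gt_eqF//; apply: le_trans (expR_ge1Dx _); rewrite lerD2l.
  rewrite mulNr -mulrN; apply: ler_wpM2l; first exact: ltW.
  rewrite lerNr -{2}[- x^-1]expRK ler_ln ?posrE ?expR_gt0//; exact: expR_ge1Dx.
rewrite mulrC ler_pdivlMl//; have := powR_gt0 (- e) x0; nra.
Qed.

(** A bound on the sum over [j >= 1] of [(2 / j) `^ theta], the total cost of removing
    all interior points of a partition. *)
Definition zeta_bound (theta : R) : R := 2 `^ theta * (1 + (theta - 1)^-1).

Lemma zeta_bound_ge0 theta : 1 < theta -> 0 <= zeta_bound theta.
Proof.
by move=> h; rewrite mulr_ge0 ?powR_ge0// addr_ge0// invr_ge0 subr_ge0 ltW.
Qed.

Lemma sum_powR_le theta n : 1 < theta ->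
  \sum_(j < n) (2 / j.+1%:R) `^ theta <= zeta_bound theta.
Proof.
move=> th1; have e0 : 0 < theta - 1 by rewrite subr_gt0.
set e := theta - 1 in e0; have thE : theta = 1 + e by rewrite /e addrC subrK.
have S k : \sum_(j < k.+1) (j.+1%:R : R) `^ (- theta) <= 1 + e^-1 - e^-1 * k.+1%:R `^ (- e).
  elim: k => [|k IH]; first by rewrite big_ord1 powR1 mulr1 addrK.
  rewrite big_ord_recr /=; apply: (le_trans (lerD IH (lexx _))).
  have := @powR_neg_step e k.+2%:R e0; rewrite ltr1n => /(_ isT).
  rewrite thE (_ : k.+2%:R - 1 = k.+1%:R :> R); last by rewrite -natr1 addrK.
  lra.
have T k : \sum_(j < k.+1) (2 / j.+1%:R) `^ theta <= zeta_bound theta.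
  under eq_bigr => j _.
    rewrite powRM ?invr_ge0// -[j.+1%:R^-1]powR_inv1// -powRrM mulN1r; over.
  rewrite -mulr_sumr; apply: ler_wpM2l; first exact: powR_ge0.
  apply: (le_trans (S k)); rewrite -/e gerBl mulr_ge0 ?powR_ge0// invr_ge0 ltW//.
case: n => [|n]; last exact: T.
by rewrite big_ord0 zeta_bound_ge0.
Qed.

End ZetaBound.

Section Young.
Context {R : realType}.
Implicit Types (p q s t : R) (l : seq R) (H A W : R -> R).

Definition rs H A := psum (fun x y => H x * (A y - A x)).

(** The interior points of a chain, which are those that may be removed, correspond
    to its consecutive triples. *)
Fixpoint tsum (phi : R -> R -> R -> R) s l : R :=
  if l is u :: l' then (if l' is t :: _ then phi s u t else 0) + tsum phi u l'
  else 0.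

Lemma tsum_min phi s u l : (0 < size l)%N ->
  exists l1 x y l2, u :: l = l1 ++ x :: y :: l2 /\
    phi (last s l1) x y * (size l)%:R <= tsum phi s (u :: l).
Proof.
elim: l s u => [//|t l IH] s u _.
case: (posnP (size l)) => [/size0nil ->|l0].
  by exists [::], u, t, [::]; split => //=; rewrite mulr1 !addr0.
have [l1 [x [y [l2 [e le]]]]] := IH u t l0.
have [h|h] := leP (phi s u t) (phi (last u l1) x y).
  exists [::], u, t, l; split => //=.
  rewrite -[(size l).+1%:R]nat1r mulrDr mulr1 lerD2l; apply: le_trans le.
  by apply: ler_wpM2r.
exists (u :: l1), x, y, l2; split; first by rewrite e.
rewrite -[(size _)%:R]nat1r mulrDr mulr1 /=; apply: lerD; first exact: ltW.
exact: le.
Qed.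

Lemma path_lt_bounds s l x : path <%R s l -> x \in s :: l -> s <= x <= last s l.
Proof.
move=> pl; apply: (@chain_bounds _ `]-oo, +oo[).
rewrite /chain (sub_path _ pl); last by move=> ? ? /ltW.
by apply/allP => y _; rewrite in_itv.
Qed.

Section Estimate.
Variables (p q : R) (H A WH WA : R -> R) (s t hv : R).
Hypotheses (p0 : 0 < p) (q0 : 0 < q) (hv0 : 0 <= hv).
Hypothesis HW : forall x y, x \in `[s, t[ -> y \in `[s, t[ -> x <= y ->
  incr p H x y <= WH y - WH x.
Hypothesis WHv : forall x, x \in `[s, t[ -> 0 <= WH x <= hv `^ p.
Hypothesis AW : forall x y, x \in `[s, t] -> y \in `[s, t] -> x <= y ->
  incr q A x y <= WA y - WA x.

Let theta := p^-1 + q^-1.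
Let om := WA t - WA s.

Let WA_mono x y : s <= x -> x <= y -> y <= t -> WA x <= WA y.
Proof.
move=> sx xy yt; rewrite -subr_ge0; apply: le_trans (AW _ _ xy).
- exact: powR_ge0.
- by rewrite in_itv/= sx (le_trans xy).
- by rewrite in_itv/= yt (le_trans sx).
Qed.

Let phi x y z := (WH y - WH x) * om + (WA z - WA y) * hv `^ p.

(** Both parts of [phi] telescope, the second one with a shift by one point. *)
Let tsum_le r u l : s <= r -> path <%R r (u :: l) -> last u l = t ->
  tsum phi r (u :: l) <= (hv `^ p - WH r) * om + (WA t - WA u) * hv `^ p.
Proof.
have om0 : s <= t -> 0 <= om by move=> st; rewrite subr_ge0 WA_mono.
elim: l r u => [|v l IH] r u sr.
  move=> /= /andP[ru _] ut; rewrite ut !addr0 in ru *.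
  have rI : r \in `[s, t[ by rewrite in_itv/= sr.
  have /andP[_ h] := WHv rI.
  rewrite subrr mul0r addr0; apply: mulr_ge0; first by rewrite subr_ge0.
  by apply: om0; rewrite (le_trans sr)// ltW.
move=> /=; rewrite -!/(path _ _ _) => /and3P[ru uv vl] vt.
have := IH u v _ _ vt; rewrite /= uv vl => /(_ (le_trans sr (ltW ru)) isT).
by rewrite /phi; lra.
Qed.

(** A triple of small [phi] has a small share of each of the two controls; the
    factor [2] is the price for having both at once. *)
Let remove_bound x y z (m : nat) : s <= x -> x < y -> y < z -> z <= t ->
  phi x y z * m.+1%:R <= 2 * (hv `^ p * om) ->
  `|H y - H x| * `|A z - A y| <= hv * om `^ q^-1 * (2 / m.+1%:R) `^ theta.
Proof.
move=> sx xy yz zt; set k : R := m.+1%:R => le.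
have k0 : 0 < k by rewrite ltr0n.
have sy := le_trans sx (ltW xy); have yt := le_trans (ltW yz) zt.
have xI : x \in `[s, t[ by rewrite in_itv/= sx (lt_le_trans xy).
have yI : y \in `[s, t[ by rewrite in_itv/= sy (lt_le_trans yz).
have hH := HW xI yI (ltW xy).
have hA : incr q A y z <= WA z - WA y.
  by apply: AW (ltW yz); rewrite in_itv/= ?sy ?yt// zt (le_trans sy)// ltW.
have dH : 0 <= WH y - WH x by apply: le_trans hH; exact: powR_ge0.
have dA : 0 <= WA z - WA y by apply: le_trans hA; exact: powR_ge0.
have dA' : WA z - WA y <= om.
  by apply: lerB; apply: WA_mono => //; rewrite (le_trans sy)// ltW.
have om0 : 0 <= om by apply: le_trans dA'.
have R0 : 0 <= hv * om `^ q^-1 * (2 / k) `^ theta by rewrite !mulr_ge0 ?powR_ge0.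
have [hv00|hvp] := eqVneq hv 0.
  have := WHv xI; have := WHv yI; rewrite hv00 powR0 ?gt_eqF// => /andP[_ a] /andP[b _].
  have : incr p H x y <= 0 `^ p by rewrite powR0 ?gt_eqF//; lra.
  move/(powR_le_inv p0 (normr_ge0 _) (lexx _)); rewrite normr_le0 => /eqP ->.
  by rewrite normr0 mul0r mulr_ge0 ?powR_ge0// mul0r.
have {}hvp : 0 < hv by rewrite lt_neqAle eq_sym hvp.
have [om00|omp] := eqVneq om 0.
  have : incr q A y z <= 0 `^ q by rewrite powR0 ?gt_eqF//; lra.
  move/(powR_le_inv q0 (normr_ge0 _) (lexx _)); rewrite normr_le0 => /eqP ->.
  by rewrite normr0 mulr0.
have {}omp : 0 < om by rewrite lt_neqAle eq_sym omp.
have hp := powR_gt0 p hvp.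
have k2 : 0 <= 2 / k by rewrite divr_ge0// ltW.
have bH : `|H y - H x| <= hv * (2 / k) `^ p^-1.
  apply: (@powR_le_inv _ p) => //; first by rewrite mulr_ge0// powR_ge0.
  rewrite powRM ?powR_ge0// powRVK ?gt_eqF//; apply: (le_trans hH).
  rewrite mulrA ler_pdivlMr// -(ler_pM2r omp); apply: le_trans (_ : _ <= 2 * (hv `^ p * om)) _; last by lra.
  apply: le_trans le; rewrite /phi; have := mulr_ge0 (mulr_ge0 dA (ltW hp)) (ltW k0); lra.
have bA : `|A z - A y| <= om `^ q^-1 * (2 / k) `^ q^-1.
  apply: (@powR_le_inv _ q) => //; first by rewrite mulr_ge0 ?powR_ge0.
  rewrite powRM ?powR_ge0// !powRVK ?gt_eqF//; apply: (le_trans hA).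
  rewrite mulrA ler_pdivlMr// -(ler_pM2r hp); apply: le_trans (_ : _ <= 2 * (hv `^ p * om)) _; last by lra.
  apply: le_trans le; rewrite /phi; have := mulr_ge0 (mulr_ge0 dH (ltW omp)) (ltW k0); lra.
apply: (le_trans (ler_pM (normr_ge0 _) (normr_ge0 _) bH bA)).
rewrite /theta powRD; last by rewrite (@gt_eqF _ _ (2 / k) 0) ?implybT// divr_gt0.
by rewrite le_eqVlt; apply/orP; left; apply/eqP; ring.
Qed.

Let path_remove r x y l1 l2 : path <%R r (l1 ++ x :: y :: l2) ->
  path <%R r (l1 ++ y :: l2) /\ last r l1 < x < y.
Proof.
rewrite !cat_path /= => /and4P[-> a b ->]; rewrite a b (lt_trans a b); split => //.
Qed.

(** Points are removed one at a time. Among the consecutive triples of the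
    chain, one carries at most the average of the two controls, and removing its
    middle point changes the sum by the product of an increment of [H] and
    an increment of [A]; since [1/p + 1/q > 1] the resulting costs are summable.
    The value of [H] at the right end never enters, so [H] need only be
    controlled on the half-open interval. *)
Lemma young_chain l : path <%R s l -> last s l = t ->
  `|rs H A s l - H s * (A t - A s)| <=
    hv * om `^ q^-1 * \sum_(j < (size l).-1) (2 / j.+1%:R) `^ theta.
Proof.
move sz: (size l) => n; elim: n l sz => [|n IH] [|u l]//=.
  by move=> _ _ <-; rewrite /rs /= subrr mulr0 subrr normr0 big_ord0 mulr0.
case: n IH => [|n] IH [sz].
  by move: sz => /size0nil -> /= _ <-; rewrite /rs/= addr0 subrr normr0 big_ord0 mulr0.
move=> pl lt.
have [|l1 [x [y [l2 [e le]]]]] := @tsum_min phi s u l; first by rewrite sz.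
have pl' : path <%R s (u :: l) by [].
have lt' : last s (u :: l) = t by [].
rewrite -[_ :: _]/(u :: l) e in pl' lt'.
have [pr /andP[rx xy]] := path_remove pl'.
have sz' : size (l1 ++ y :: l2) = n.+1.
  have /(congr1 size) := e; rewrite /= sz !size_cat /= addnS => -[->].
  by rewrite addnS.
have lr : last s (l1 ++ y :: l2) = t by rewrite -lt' !last_cat.
rewrite big_ord_recr /= [leRHS]mulrDr.
rewrite (_ : rs H A s (u :: l) - _ = (rs H A s (l1 ++ y :: l2) - H s * (A t - A s))
  + (H x - H (last s l1)) * (A y - A x)); last first.
  by rewrite e /rs !psum_cat /=; ring.
apply: (le_trans (ler_normD _ _)); apply: lerD; first exact: IH.
rewrite normrM; apply: remove_bound => //.
- move: pl'; rewrite cat_path => /andP[p1 _].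
  by have /andP[] := path_lt_bounds p1 (mem_last s l1).
- move: pr; rewrite cat_path /= => /and3P[_ _ p2].
  by have /andP[_] := path_lt_bounds p2 (mem_head y l2); rewrite -lr last_cat.
rewrite sz in le; apply: (le_trans le); apply: (le_trans (tsum_le _ _ _)) => //.
have us : s < u by case/andP: pl.
have ut : u <= t.
  case/andP: pl => _ pul.
  by have /andP[] := path_lt_bounds pul (mem_last u l); rewrite lt.
have sI : s \in `[s, t[ by rewrite in_itv/= lexx (lt_le_trans us).
have /andP[h0 _] := WHv sI.
have a1 : 0 <= om by rewrite subr_ge0 WA_mono// (le_trans (ltW us)).
have a2 : WA t - WA u <= om by rewrite lerD2l lerN2 WA_mono// ltW.
have := ler_wpM2r (powR_ge0 hv p) a2; have := mulr_ge0 h0 a1.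
by lra.
Qed.

Lemma young_estimate l : 1 < theta -> path <%R s l -> last s l = t ->
  `|rs H A s l| <= (`|H s| + zeta_bound theta * hv) * om `^ q^-1.
Proof.
move=> th pl lt.
have st : s <= t.
  by have/andP[] := path_lt_bounds pl (mem_last s l); rewrite lt.
have yc := young_chain pl lt.
have hA : `|A t - A s| <= om `^ q^-1.
  apply: (@powR_le_inv _ q) => //; rewrite ?powR_ge0// powRVK ?gt_eqF//.
    by apply: AW; rewrite ?in_itv/= ?lexx ?st.
  by rewrite subr_ge0 WA_mono.
rewrite -[rs H A s l](subrK (H s * (A t - A s))); apply: (le_trans (ler_normD _ _)).
rewrite mulrDl addrC; apply: lerD; first by rewrite normrM; apply: ler_wpM2l.
apply: (le_trans yc); rewrite [leRHS]mulrC [in leRHS](mulrC _ hv) mulrA [om `^ _ * _]mulrC.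
apply: ler_wpM2l; first by rewrite mulr_ge0// powR_ge0.
exact: sum_powR_le.
Qed.

End Estimate.
End Young.

(** * Reflection acts only at the barrier *)

Section NullSets.
Context d (T : measurableType d) (R : realType) (mu : {measure set T -> \bar R}).
Local Open Scope classical_set_scope.
Local Open Scope ring_scope.
Import HBNNSimple.

(** The integral of a non-negative function is a supremum over the simple functions
    below it, one of which is [c] times the indicator of [E]; this holds whether or
    not [f] is measurable. *)
Lemma ge0_integral0_null (D E : set T) (f : T -> \bar R) (c : R) :
  measurable E -> E `<=` D -> (forall x, D x -> (0 <= f x)%E) -> 0 < c ->
  (forall x, E x -> (c%:E <= f x)%E) ->
  (\int[mu]_(x in D) f x = 0)%E -> mu E = 0%E.
Proof.
move=> mE ED f0 c0 cf I0.
pose h := scale_nnsfun (indic_nnsfun R mE) (ltW c0).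
have hE x : h x = c * \1_E x by [].
have : (sintegral mu h <= 0)%E.
  rewrite -I0 ge0_integralE//; apply: ereal_sup_ubound; exists h => // x.
  change ((h x)%:E <= (f \_ D) x)%E; rewrite hE indicE /patch; case: (boolP (x \in D)) => xD.
    have [xE|xE] := boolP (x \in E).
      by rewrite mulr1; apply: cf; rewrite inE in xE.
    by rewrite mulr0; apply: f0; rewrite inE in xD.
  have [xE|xE] := boolP (x \in E); last by rewrite mulr0.
  by move: xD; rewrite notin_setE => xD; rewrite inE in xE; have := ED _ xE.
rewrite sintegralrM sintegral_indic// => h0; apply/eqP.
rewrite eq_le measure_ge0 andbT.
by rewrite -(@pmule_rle0 _ c%:E) ?lte_fin.
Qed.

End NullSets.

Section FlatOff.
Context {R : realType}.
Local Open Scope classical_set_scope.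
Local Open Scope ring_scope.

Lemma stieltjes_itvoc (F : cumulative R R) (a b : R) : a <= b ->
  lebesgue_stieltjes_measure F `]a, b] = (F b - F a)%:E.
Proof.
move=> ab; rewrite /lebesgue_stieltjes_measure /= /measure_extension measurable_mu_extE/=; last exact: is_ocitv.
by rewrite wlength_itv_bnd.
Qed.

(** The left end [b] is included, so that a jump of [F] at [b] is charged. *)
Lemma stieltjes_itvcc_ge (F : cumulative R R) (a b c m : R) : a < b -> b <= c ->
  (forall x, a <= x < b -> m <= F c - F x) ->
  (m%:E <= lebesgue_stieltjes_measure F `[b, c])%E.
Proof.
move=> ab bc Fm; pose G n := `]b - (b - a) / n.+1%:R, c]%classic : set (measurableTypeR R).
have d0 n : 0 < (b - a) / n.+1%:R by rewrite divr_gt0// subr_gt0.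
have dle n : a <= b - (b - a) / n.+1%:R.
  rewrite lerBrDr -lerBrDl ler_pdivrMr// ler_peMr ?ler1n// subr_ge0; exact: ltW.
have GE n : lebesgue_stieltjes_measure F (G n) = (F c - F (b - (b - a) / n.+1%:R))%:E.
  by apply: stieltjes_itvoc; apply: le_trans bc; rewrite gerBl ltW.
have bigG : \bigcap_n G n = `[b, c]%classic.
  apply/seteqP; split=> x /=; rewrite in_itv/=; last first.
    move=> /andP[bx xc] n _; rewrite /G/= in_itv/= xc andbT.
    by apply: lt_le_trans bx; rewrite gtrBl.
  move=> Gx; have := Gx 0%N I; rewrite /G /= in_itv/= => /andP[_ xc].
  rewrite xc andbT leNgt; apply/negP => xb.
  have [n nx] : exists n : nat, (b - a) / (b - x) < n%:R.
    by exists (Num.bound ((b - a) / (b - x))); rewrite archi_boundP// divr_ge0// subr_ge0 ltW.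
  have := Gx n I; rewrite /G /= in_itv/= xc andbT ltrBlDl -ltrBlDr.
  rewrite ltNge => /negP; apply; rewrite ler_pdivrMr// -ler_pdivrMl ?subr_gt0//.
  by rewrite mulrC; apply: (le_trans (ltW nx)); rewrite ler_nat.
have cv : (lebesgue_stieltjes_measure F \o G) n @[n --> \oo] --> lebesgue_stieltjes_measure F `[b, c].
  rewrite -bigG; apply: nonincreasing_cvg_mu.
  - by change (lebesgue_stieltjes_measure F (G 0%N) < +oo)%E; rewrite GE ltry.
  - by move=> n; exact: measurable_itv.
  - by rewrite bigG; exact: measurable_itv.
  - move=> i j ij; apply/subsetPset => x; rewrite /G /= !in_itv/= => /andP[jx ->].
    rewrite andbT; apply: le_lt_trans jx; rewrite lerD2l lerN2.
    by apply: ler_wpM2l; rewrite ?subr_ge0 ?(ltW ab)// lef_pV2 ?posrE// ler_nat.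
rewrite -(cvg_lim _ cv)//; apply: lime_ge; first by apply/cvg_ex; eexists; exact: cv.
apply: nearW => n /=; rewrite GE lee_fin; apply: Fm.
by rewrite dle gtrBl d0.
Qed.

(** [k] can only increase at times where [g] comes arbitrarily close to [0]:
    otherwise [g] would be bounded away from [0] on a set charged by [dk]. *)
Lemma stieltjes_flat_off (T : R) (g k : R -> R) :
  (forall t, 0 <= t <= T -> 0 <= g t) ->
  {in `[0, T] &, {homo k : s t / s <= t}} ->
  stieltjes_integral0 T g k ->
  forall s t e, 0 <= s -> s < t -> t <= T -> k s < k t -> 0 < e ->
  exists2 u, s < u <= t & k t <= k u - g u + e.
Proof.
move=> g0 kmono [F Fk I0] s t e s0 st tT kst e0.
apply: contrapT => no.
have gbig u : s < u <= t -> k u - g u + e < k t.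
  by move=> su; rewrite ltNge; apply/negP => le; apply: no; exists u.
pose c := Num.min (e / 2) ((k t - k s) / 2).
have c0 : 0 < c by rewrite lt_min !divr_gt0// subr_gt0.
have ce : c <= e / 2 by rewrite ge_min lexx.
have cs : c <= (k t - k s) / 2 by rewrite ge_min lexx orbT.
(* From [inf S] on, [k] stays within [e / 2] of its final value; before that time it
   misses it by more than [c]. *)
pose S := [set u | s <= u <= t /\ k t - c <= k u].
have St : S t by split; [rewrite lexx ltW|lra].
have Slb : lbound S s by move=> x [/andP[]].
have Sinf : has_inf S by split; [exists t|exists s].
pose sg := inf S.
have ssg : s <= sg by apply: lb_le_inf => //; exists t.
have sgt : sg <= t by apply: ge_inf => //; exists s.
have tI x : 0 <= x -> x <= T -> x \in `[0, T] by move=> x0 xT; rewrite in_itv/= x0.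
have sg0 := le_trans s0 ssg.
have low x : s <= x -> x < sg -> k x < k t - c.
  move=> sx xsg; rewrite ltNge; apply/negP => kx.
  have : sg <= x by apply: ge_inf; [exists s|split => //; rewrite sx (le_trans (ltW xsg))].
  by rewrite leNgt xsg.
have ksg : k t - c <= k sg.
  rewrite leNgt; apply/negP => lt.
  have [d Fd] := @nondecreasing_right_continuousP _ sg ((k t - c - k sg) / 2) F ltac:(lra).
  have [u [/andP[su ut] ku] ud] := inf_adherent (gt0 d) Sinf.
  have : F u <= F (sg + d%:num) by apply: cumulative_is_nondecreasing; exact: ltW.
  rewrite (Fk u) ?tI ?(le_trans s0 su) ?(le_trans ut)//.
  by move: Fd; rewrite (Fk sg) ?tI ?(le_trans sgt)//; lra.
have ssg' : s < sg.
  rewrite lt_neqAle ssg andbT; apply/eqP => E; move: ksg; rewrite -E; lra.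
have m0 : lebesgue_stieltjes_measure F `[sg, t] = 0%E.
  apply: (@ge0_integral0_null _ (measurableTypeR R) R (lebesgue_stieltjes_measure F) `]0, t]%classic _ (EFin \o g) (e / 2)).
  - exact: measurable_itv.
  - move=> x /=; rewrite !in_itv/= => /andP[sx ->]; rewrite andbT.
    by apply: lt_le_trans sx; apply: le_lt_trans ssg'.
  - move=> x /=; rewrite in_itv/= => /andP[x0 xt]; rewrite lee_fin g0// (ltW x0)//.
    exact: le_trans tT.
  - lra.
  - move=> x /=; rewrite in_itv/= lee_fin => /andP[sx xt].
    have := gbig x; rewrite (lt_le_trans ssg' sx) xt => /(_ isT).
    have : k sg <= k x by apply: kmono => //; apply: tI; rewrite ?(le_trans sg0) ?(le_trans _ tT).
    by move: ksg ce; lra.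
  - by apply: I0; rewrite tT andbT (le_trans s0)// ltW.
have : (c%:E <= lebesgue_stieltjes_measure F `[sg, t])%E.
  apply: (@stieltjes_itvcc_ge F s) => // x /andP[sx xsg].
  have xt := le_trans (ltW xsg) sgt.
  have -> : F t = k t by apply: Fk; apply: tI => //; rewrite (le_trans s0)// ltW.
  have -> : F x = k x.
    by apply: Fk; apply: tI; [rewrite (le_trans s0)|rewrite (le_trans xt)].
  have := low x sx xsg; lra.
by rewrite m0 lee_fin leNgt c0.
Qed.

End FlatOff.

(** * Variation of the difference of two reflection terms *)

Section Reflection.
Context {R : realType}.
Implicit Types (p s t v e : R) (l : seq R) (I : interval R) (D delta : R -> R).

(** The tolerance [e] is there because the paths may jump: the extremal values of
    [delta] need not be attained. *)
Definition rises I e D delta := forall s t, s \in I -> t \in I -> s < t ->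
  D s < D t -> exists2 u, s < u <= t & D t <= delta u + e.

Definition opp D : R -> R := fun x => - D x.

Lemma psum_incr_opp p D s l : psum (incr p (opp D)) s l = psum (incr p D) s l.
Proof.
by elim: l s => [//|t l IH] s /=; rewrite IH /incr /opp -opprD normrN.
Qed.

Lemma rises_opp2 I e D delta : rises I e D delta ->
  rises I e (opp (opp D)) (opp (opp delta)).
Proof.
move=> H s t sI tI st Dst; have [|u su le] := H s t sI tI st.
  by move: Dst; rewrite /opp !opprK.
by exists u; rewrite // /opp !opprK.
Qed.

Definition separated e D := path (fun x y => (D x == D y) || (4 * e <= `|D y - D x|)).

Lemma separated_opp e D s l : separated e D s l -> separated e (opp D) s l.
Proof.
by apply: sub_path => x y; rewrite /opp eqr_opp -opprD normrN.
Qed.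

(** Along a finite chain the tolerance can be chosen small against every nonzero
    step of [D], so that it costs no more than a factor [2]. *)
Lemma separated_exists D s l : exists2 e, 0 < e & separated e D s l.
Proof.
elim: l s => [|t l IH] s; first by exists 1.
have [e e0 sep] := IH t.
have [eq|ne] := eqVneq (D s) (D t); first by exists e => //=; rewrite eq eqxx.
have d0 : 0 < `|D t - D s| / 4 by rewrite divr_gt0// normr_gt0 subr_eq0 eq_sym.
exists (Num.min e (`|D t - D s| / 4)); first by rewrite lt_min e0.
have m1 : Num.min e (`|D t - D s| / 4) <= e by rewrite ge_min lexx.
have m2 : Num.min e (`|D t - D s| / 4) <= `|D t - D s| / 4 by rewrite ge_min lexx orbT.
rewrite /separated /=; apply/andP; split; first by apply/orP; right; lra.
apply: sub_path sep => x y /orP[->//|h]; apply/orP; right; apply: le_trans h.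
by rewrite ler_pM2l.
Qed.

Lemma mem_between I s t u : s \in I -> t \in I -> s <= u -> u <= t -> u \in I.
Proof.
move=> sI tI su ut; have := @interval_is_interval R I s t sI tI u.
by rewrite su ut => /(_ isT).
Qed.

(** The chain is cut into maximal monotone runs of [D]; for [p >= 1] merging the steps
    of a run can only increase the sum. Here the current run goes up from time [r] to
    time [s]. Up to the tolerance, its bottom lies above [delta w], its top lies below
    [delta u], and [w <= u], so that the run is at most twice the increment of [delta]
    from [w] to [u]. When the run ends, [u] becomes the starting witness of the next
    one, which goes down: the roles of [D] and [opp D] are exchanged. *)
Lemma run_bound p I e l D delta w r u s : 1 <= p -> 0 < e ->
  rises I e D delta -> rises I e (opp D) (opp delta) ->
  w \in I -> u \in I -> w <= u -> u <= s ->
  D r + 4 * e <= D s -> delta w <= D r + e -> D s <= delta u + e ->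
  separated e D s l -> chain I s l ->
  exists2 l', chain I w l' &
    `|D s - D r| `^ p + psum (incr p D) s l <= 2 `^ p * psum (incr p delta) w l'.
Proof.
move=> p1 e0; have p0 : 0 <= p by apply: le_trans p1.
elim: l D delta w r u s => [|t l IH] D delta w r u s up down wI uI wu us rs dw du.
  move=> _ _; exists [:: u]; first by rewrite chain_cons wu wI /chain /= uI.
  rewrite /= !addr0 /incr -powRM//; apply: le_powR => //.
  by rewrite !ger0_norm; lra.
move=> /= /andP[sepst sep]; rewrite chain_cons => /and3P[st sI c].
have tI : t \in I by apply: chain_mem c _; rewrite mem_head.
have ut := le_trans us st.
case: (ltgtP (D s) (D t)) => [Dst|Dts|Dst]; last first.
- rewrite {1}/incr -Dst subrr normr0 powR0 ?add0r ?gt_eqF//; last by lra.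
  have := IH D delta w r u t up down wI uI wu ut.
  by rewrite -Dst; apply.
- have lt_st : s < t by rewrite lt_neqAle st andbT; apply: contraTneq Dts => ->; rewrite ltxx.
  move: sepst; rewrite gt_eqF//= ltr0_norm ?subr_lt0// => sepst.
  have [|u' /andP[su' ut'] hu'] := down s t sI tI lt_st; first by rewrite /opp ltrN2.
  have u'I := mem_between sI tI (ltW su') ut'.
  have [l' cl' le] := IH (opp D) (opp delta) u s u' t down (rises_opp2 up) uI u'I
    (le_trans us (ltW su')) ut' ltac:(rewrite /opp; lra) ltac:(rewrite /opp; lra)
    hu' (separated_opp sep) c.
  exists (u :: l'); first by rewrite chain_cons wu wI.
  move: le; rewrite !psum_incr_opp /= mulrDr [opp D t - _](_ : _ = - (D t - D s)); last by rewrite /opp; ring.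
  rewrite normrN => le; apply: lerD; last exact: le.
  rewrite /incr -powRM//; apply: le_powR => //.
  by rewrite !ger0_norm; lra.
- have lt_st : s < t by rewrite lt_neqAle st andbT; apply: contraTneq Dst => ->; rewrite ltxx.
  have [u' /andP[su' ut'] hu'] := up s t sI tI lt_st Dst.
  have u'I := mem_between sI tI (ltW su') ut'.
  have [l' cl' le] := IH D delta w r u' t up down wI u'I
    (le_trans wu (le_trans us (ltW su'))) ut' ltac:(lra) dw hu' sep c.
  exists l' => //; apply: le_trans le; rewrite addrA lerD2r /incr.
  apply: (le_trans (powR_superadd p1 (normr_ge0 _) (normr_ge0 _))).
  apply: le_powR => //.
  by rewrite !ger0_norm; lra.
Qed.

Lemma runs_bound p I e l D delta w s : 1 <= p -> 0 < e ->
  rises I e D delta -> rises I e (opp D) (opp delta) ->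
  w \in I -> w <= s -> delta w = D s ->
  separated e D s l -> chain I s l ->
  exists2 l', chain I w l' & psum (incr p D) s l <= 2 `^ p * psum (incr p delta) w l'.
Proof.
move=> p1 e0 + + wI; have p0 : 0 <= p by apply: le_trans p1.
elim: l s => [|t l IH] s up down ws dw.
  by exists [::]; rewrite ?mulr0// /chain /= wI.
move=> /= /andP[sepst sep]; rewrite chain_cons => /and3P[st sI c].
have tI : t \in I by apply: chain_mem c _; rewrite mem_head.
case: (ltgtP (D s) (D t)) => [Dst|Dts|Dst]; last first.
- rewrite {1}/incr -Dst subrr normr0 powR0 ?add0r ?gt_eqF//; last by lra.
  by apply: IH => //; [exact: le_trans st|rewrite -Dst].
- have lt_st : s < t by rewrite lt_neqAle st andbT; apply: contraTneq Dts => ->; rewrite ltxx.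
  move: sepst; rewrite gt_eqF//= ltr0_norm ?subr_lt0// => sepst.
  have [|u /andP[su ut] hu] := down s t sI tI lt_st; first by rewrite /opp ltrN2.
  have uI := mem_between sI tI (ltW su) ut.
  have [l' cl' le] := @run_bound p I e l (opp D) (opp delta) w s u t p1 e0 down
    (rises_opp2 up) wI uI (le_trans ws (ltW su)) ut ltac:(rewrite /opp; lra)
    ltac:(rewrite /opp; lra) hu (separated_opp sep) c.
  exists l' => //; move: le; rewrite !psum_incr_opp; apply: le_trans.
  by rewrite lerD2r /incr /opp -opprD normrN.
- have lt_st : s < t by rewrite lt_neqAle st andbT; apply: contraTneq Dst => ->; rewrite ltxx.
  move: sepst; rewrite lt_eqF//= gtr0_norm ?subr_gt0// => sepst.
  have [u /andP[su ut] hu] := up s t sI tI lt_st Dst.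
  have uI := mem_between sI tI (ltW su) ut.
  by have [l' cl' le] := @run_bound p I e l D delta w s u t p1 e0 up down wI uI
    (le_trans ws (ltW su)) ut ltac:(lra) ltac:(lra) hu sep c; exists l'.
Qed.

Lemma rises_bvar p (a b v : R) D delta : 1 <= p -> 0 <= v ->
  (forall e, 0 < e -> rises `[a, b] e D delta /\ rises `[a, b] e (opp D) (opp delta)) ->
  `|delta a - D a| <= v ->
  bvar p `[a, b] delta v -> bvar p `[a, b] D (8 * v).
Proof.
move=> p1 v0 H da dv; have p0 : 0 < p by apply: lt_le_trans p1.
(* [delta] is changed at the single time [a] so as to agree there with [D]; the
   witnesses of a rise are later than [a]. *)
pose kap x := if x <= a then D a - delta a else 0.
pose del x := delta x + kap x.
have kapv : bvar p `[a, b] kap v.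
  apply: (@bvar_of_control _ _ _ _ (fun x => if x <= a then 0 else v `^ p) v 0) => //.
    move=> s t; rewrite !in_itv/= => /andP[sa _] /andP[ta _] st; rewrite /incr /kap.
    have [ta'|at'] := leP t a; have [sa'|as'] := leP s a.
    - by rewrite !subrr normr0 powR0 ?gt_eqF.
    - by have := lt_le_trans as' (le_trans st ta'); rewrite ltxx.
    - by rewrite sub0r opprB subr0; apply: le_powR => //; exact: ltW.
    - by rewrite !subrr normr0 powR0 ?gt_eqF.
  by move=> t _; rewrite add0r; case: ifP => _; rewrite ?lexx powR_ge0.
have delv : bvar p `[a, b] del (4 * v).
  apply: (bvar_dom2 p1 v0 _ dv kapv) => s t _ _ _.
  by apply: le_trans (ler_normD _ _); rewrite /del addrACA opprD.
move=> s l c.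
have sI : s \in `[a, b] by apply: chain_mem c _; rewrite mem_head.
move: (sI); rewrite in_itv/= => /andP[a_s sb].
have aI : a \in `[a, b] by rewrite in_itv/= lexx (le_trans a_s).
have [e e0 sep] := separated_exists D a (s :: l).
have [up down] := H e e0.
have del_rises D' d' (g : R -> R) : (forall u, a < u -> g u = d' u) ->
    rises `[a, b] e D' d' -> rises `[a, b] e D' g.
  move=> gd h x y xI yI xy Dxy; have [u /andP[xu uy] le] := h x y xI yI xy Dxy.
  exists u; rewrite ?xu// gd//; apply: le_lt_trans xu.
  by move: xI; rewrite in_itv/= => /andP[].
have delE u : a < u -> del u = delta u.
  by move=> au; rewrite /del /kap leNgt au /= addr0.
have [||||l' cl' le] := @runs_bound p `[a, b] e (s :: l) D del a a p1 e0 _ _ aI (lexx a) _ sep _.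
- exact: del_rises up.
- by apply: del_rises down => u au; rewrite /opp delE.
- by rewrite /del /kap lexx addrC subrK.
- by rewrite chain_cons a_s aI.
apply: (@le_trans _ _ (psum (incr p D) a (s :: l))).
  by rewrite /= lerDr powR_ge0.
apply: (le_trans le); rewrite (_ : 8 * v = 2 * (4 * v)); last by ring.
rewrite (powRM p (ler0n _ 2)) ?mulr_ge0//; apply: ler_wpM2l; first exact: powR_ge0.
exact: delv.
Qed.

(** [x] stands for the level below which the reflecting term [k] may not fall; by
    minimality [k] increases only where it touches [x]. When one of two such
    terms gains on the other, it touches its own level, whereas the other one
    still lies above its level, so the difference of the terms follows the
    difference of the levels. *)
Lemma reflection_bvar p (a b v : R) (k k' x x' : R -> R) : 1 <= p -> 0 <= v ->
  {in `[a, b] &, {homo k : s t / s <= t}} ->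
  {in `[a, b] &, {homo k' : s t / s <= t}} ->
  (forall t, t \in `[a, b] -> x t <= k t) ->
  (forall t, t \in `[a, b] -> x' t <= k' t) ->
  (forall e, 0 < e -> rises `[a, b] e k x) ->
  (forall e, 0 < e -> rises `[a, b] e k' x') ->
  `|(x a - x' a) - (k a - k' a)| <= v ->
  bvar p `[a, b] (fun t => x t - x' t) v ->
  bvar p `[a, b] (fun t => k t - k' t) (8 * v).
Proof.
move=> p1 v0 mk mk' xk xk' rk rk' av.
apply: rises_bvar => // e e0; split=> s t sI tI st h.
  have kst : k s < k t by have := mk' _ _ sI tI (ltW st); lra.
  have [u /andP[su ut] le] := rk e e0 s t sI tI st kst.
  have uI := mem_between sI tI (ltW su) ut.
  by exists u; rewrite ?su//; have := mk' _ _ uI tI ut; have := xk' _ uI; lra.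
move: h; rewrite /opp => h.
have kst : k' s < k' t by have := mk _ _ sI tI (ltW st); lra.
have [u /andP[su ut] le] := rk' e e0 s t sI tI st kst.
have uI := mem_between sI tI (ltW su) ut.
by exists u; rewrite ?su//; have := mk _ _ uI tI ut; have := xk _ uI; lra.
Qed.

End Reflection.

(** * Bounds on the coefficients *)

Section EntryNorms.
Context {R : realType}.

Lemma eucl_ge0 n (v : 'rV[R]_n) : 0 <= eucl v.
Proof. exact: sqrtr_ge0. Qed.

Lemma coord_le_eucl n (v : 'rV[R]_n) i : `|v 0 i| <= eucl v.
Proof.
rewrite -sqrtr_sqr ler_wsqrtr// (bigD1 i)//= lerDl; apply: sumr_ge0 => j _.
exact: sqr_ge0.
Qed.

Lemma eucl_le_sum n (v : 'rV[R]_n) : eucl v <= \sum_i `|v 0 i|.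
Proof.
have S0 (P : pred 'I_n) : 0 <= \sum_(i | P i) `|v 0 i| by apply: sumr_ge0.
rewrite -[leRHS](ger0_norm (S0 _)) -sqrtr_sqr ler_wsqrtr//.
rewrite expr2 mulr_suml; apply: ler_sum => i _.
rewrite -real_normK ?num_real// expr2.
by apply: ler_wpM2l => //; rewrite (bigD1 i)//= lerDl.
Qed.

Lemma eucl_delta n (i : 'I_n) : eucl (delta_mx 0 i : 'rV[R]_n) = 1.
Proof.
rewrite /eucl (bigD1 i)//= big1 => [|j ji]; last by rewrite mxE (negbTE ji) andbF expr0n.
by rewrite mxE !eqxx expr1n addr0 sqrtr1.
Qed.

Lemma eucl0 n : eucl (0 : 'rV[R]_n) = 0.
Proof. by rewrite /eucl big1 ?sqrtr0// => i _; rewrite mxE expr0n. Qed.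

Definition entry_sum a b (B : 'M[R]_(a, b)) : R := \sum_i \sum_j `|B i j|.

(** All that is used of the norms in play, namely that they are equivalent to the
    size of the entries; this passes from [N] to the operator norm over [N]. *)
Definition entry_norm a b (N : 'M[R]_(a, b) -> R) : Prop :=
  (forall (B : 'M[R]_(a, b)) i j, `|B i j| <= N B) /\
  (exists2 c : R, 0 <= c & forall B : 'M[R]_(a, b), 0 <= N B <= c * entry_sum B).

Lemma mulmx_entry_le a b (v : 'rV[R]_a) (B : 'M[R]_(a, b)) j : eucl v <= 1 ->
  `|(v *m B) 0 j| <= entry_sum B.
Proof.
move=> v1; rewrite mxE; apply: (le_trans (ler_norm_sum _ _ _)).
apply: ler_sum => i _; rewrite normrM.
apply: (@le_trans _ _ `|B i j|).
  by rewrite ler_piMl//; apply: le_trans v1; exact: coord_le_eucl.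
by rewrite (bigD1 j)//= lerDl sumr_ge0.
Qed.

Lemma opnorm_bounds n (W : Type) (N : W -> R) (g : 'rV[R]_n -> W) (c : R) :
  (forall v, eucl v <= 1 -> 0 <= N (g v) <= c) ->
  [/\ 0 <= opnorm N g, opnorm N g <= c &
      forall v, eucl v <= 1 -> N (g v) <= opnorm N g].
Proof.
move=> Nc; have z : eucl (0 : 'rV[R]_n) <= 1 by rewrite eucl0.
have ub v : eucl v <= 1 -> N (g v) <= opnorm N g.
  move=> v1; apply: ub_le_sup; last by exists v.
  by exists c => _ [u u1 <-]; have /andP[] := Nc u u1.
split => //; first by apply: le_trans (ub _ z); have /andP[] := Nc _ z.
apply: ge_sup; first by exists (N (g 0)), 0.
by move=> _ [u u1 <-]; have /andP[] := Nc u u1.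
Qed.

Lemma row_delta a b (B : 'M[R]_(a, b)) i j : ((delta_mx 0 i : 'rV[R]_a) *m B) 0 j = B i j.
Proof. by rewrite -rowE mxE. Qed.

Lemma entry_norm_mx_opnorm d n : entry_norm (@mx_opnorm R d n).
Proof.
have b (B : 'M[R]_(d, n)) v : eucl v <= 1 -> 0 <= eucl (v *m B) <= n%:R * entry_sum B.
  move=> v1; rewrite eucl_ge0; apply: (le_trans (eucl_le_sum _)).
  rewrite -[n in n%:R]card_ord mulr_natl -sumr_const; apply: ler_sum => j _.
  exact: mulmx_entry_le.
split=> [B i j|].
  have [_ _ h] := opnorm_bounds (b B); have := h (delta_mx 0 i).
  rewrite eucl_delta => /(_ (lexx _)); apply: le_trans.
  by apply: le_trans (coord_le_eucl _ j); rewrite row_delta.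
by exists n%:R => // B; have [-> ->] := opnorm_bounds (b B).
Qed.

Lemma entry_norm_lin_opnorm k a b (N : 'M[R]_(a, b) -> R) :
  entry_norm N -> entry_norm (@lin_opnorm R k a b N).
Proof.
move=> [N1 [c c0 N2]].
have bd (B : 'M[R]_(k, a * b)) v : eucl v <= 1 ->
    0 <= N (vec_mx (v *m B)) <= c * (a%:R * b%:R) * entry_sum B.
  move=> v1; have /andP[-> h] := N2 (vec_mx (v *m B)); apply: (le_trans h).
  rewrite -mulrA; apply: ler_wpM2l => //.
  rewrite -[a in a%:R]card_ord -mulrA mulr_natl -sumr_const; apply: ler_sum => i _.
  rewrite -[b in b%:R]card_ord mulr_natl -sumr_const; apply: ler_sum => j _.
  by rewrite mxE; exact: mulmx_entry_le.
split=> [B i m|].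
  case/mxvec_indexP: m => i' j'.
  have [_ _ h] := opnorm_bounds (bd B); have := h (delta_mx 0 i).
  rewrite eucl_delta => /(_ (lexx _)); apply: le_trans.
  by apply: le_trans (N1 _ i' j'); rewrite mxE row_delta.
exists (c * (a%:R * b%:R)); first by rewrite !mulr_ge0.
by move=> B; have [-> ->] := opnorm_bounds (bd B).
Qed.

Lemma le_sup_range T (g : T -> R) x : has_ubound (range g) -> g x <= sup (range g).
Proof. by move=> ub; apply: ub_le_sup => //; exists x. Qed.

Lemma Cb_norm_ge0 j k a b (N : 'M[R]_(a, b) -> R) (g : 'rV[R]_k -> 'M[R]_(a, b)) :
  entry_norm N -> is_Cb j N g -> 0 <= Cb_norm j N g.
Proof.
elim: j a b N g => [|j IH] a b N g eN /= [_ ub h].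
  rewrite addr0; apply: le_trans (le_sup_range 0 ub).
  by case: eN => _ [c _ /(_ (g 0))/andP[]].
rewrite addr_ge0//; last by apply: IH (h.2); exact: entry_norm_lin_opnorm.
apply: le_trans (le_sup_range 0 ub).
by case: eN => _ [c _ /(_ (g 0))/andP[]].
Qed.

Lemma Cb_entry_le j k a b (N : 'M[R]_(a, b) -> R) (g : 'rV[R]_k -> 'M[R]_(a, b)) x i l :
  entry_norm N -> is_Cb j N g -> `|g x i l| <= Cb_norm j N g.
Proof.
move=> eN gC; apply: (le_trans (eN.1 _ _ _)).
case: j gC => [|j] /= [_ ub h]; have := le_sup_range x ub.
  by rewrite addr0.
move=> le; apply: (le_trans le); rewrite lerDl; apply: Cb_norm_ge0 (h.2).
exact: entry_norm_lin_opnorm.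
Qed.

(** Differentiating costs nothing, so one norm of [g] serves for all its derivatives. *)
Lemma Cb_norm_frechet_le j k a b (N : 'M[R]_(a, b) -> R) (g : 'rV[R]_k -> 'M[R]_(a, b)) :
  entry_norm N -> is_Cb j.+1 N g ->
  Cb_norm j (lin_opnorm N) (frechet g) <= Cb_norm j.+1 N g.
Proof.
move=> eN [_ ub h] /=; rewrite lerDr.
apply: le_trans (le_sup_range 0 ub).
by case: eN => _ [c _ /(_ (g 0))/andP[]].
Qed.

End EntryNorms.

Section MeanValue.
Context {R : realType}.

Definition dist1 n (x y : 'rV[R]_n) : R := \sum_k `|x 0 k - y 0 k|.

Lemma frechetE k a b (g : 'rV[R]_k -> 'M[R]_(a, b)) x h i j :
  ('d g x h) i j = \sum_l h 0 l * frechet g x l (mxvec_index i j).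
Proof.
have := mul_rV_lin1 (mxvec \o 'd g x) h.
move/rowP/(_ (mxvec_index i j)); rewrite /= mxvecE => <-.
by rewrite mxE.
Qed.

Lemma subr_mx_entry a b (B C : 'M[R]_(a, b)) i j : (B - C) i j = B i j - C i j.
Proof. by rewrite !mxE. Qed.

Lemma line_is_derive k a b (g : 'rV[R]_k -> 'M[R]_(a, b)) (y h : 'rV[R]_k) i j (t : R) :
  (forall x, differentiable g x) ->
  is_derive t 1 (fun t : R => g (y + t *: h) i j) (('d g (y + t *: h) h) i j).
Proof.
move=> dg.
have dc (M : 'M[R]_(a, b)) :
    is_diff M (fun N : 'M[R]_(a, b) => N i j) (fun N : 'M[R]_(a, b) => N i j).
  have lin : linear (fun N : 'M[R]_(a, b) => N i j) by move=> ? ? ?; rewrite !mxE.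
  pose lM := GRing.isLinear.Build _ _ _ _ _ lin.
  pose L : {linear 'M[R]_(a, b) -> R} := HB.pack (fun N : 'M[R]_(a, b) => N i j) lM.
  apply: DiffDef; first exact: differentiable_coord.
  by rewrite (@diff_lin _ _ _ L)//; exact: coord_continuous.
have dl : is_diff t (fun t : R => y + t *: h) (fun s : R => 0 + s *: h) by exact: is_diffD.
have dg' : is_diff (y + t *: h) g ('d g (y + t *: h)) by exact: DiffDef.
have dphi := is_diff_comp (is_diff_comp dl dg') (dc (g (y + t *: h))).
apply: DeriveDef.
  apply/derivable1_diffP; exact: ex_diff.
rewrite deriveE; last exact: ex_diff.
by rewrite (@diff_val _ _ _ _ _ _ _ dphi) /= add0r scale1r.
Qed.


Section Increments.
Variables (k a b : nat) (N : 'M[R]_(a, b) -> R) (g : 'rV[R]_k -> 'M[R]_(a, b)).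
Hypothesis eN : entry_norm N.

Lemma line_mvt (x y x' y' : 'rV[R]_k) i j : (forall z, differentiable g z) ->
  exists2 t : R, 0 <= t <= 1 &
    g x i j - g y i j - (g x' i j - g y' i j) =
    ('d g (y + t *: (x - y)) (x - y)) i j - ('d g (y' + t *: (x' - y')) (x' - y')) i j.
Proof.
move=> dg.
pose phi (t : R) := g (y + t *: (x - y)) i j - g (y' + t *: (x' - y')) i j.
have dphi (t : R) : is_derive t 1 phi
    (('d g (y + t *: (x - y)) (x - y)) i j - ('d g (y' + t *: (x' - y')) (x' - y')) i j).
  by apply: is_deriveB; exact: line_is_derive.
have cphi : {within `[0, 1], continuous phi}%classic.
  apply: continuous_subspaceT => t.
  by apply/differentiable_continuous/derivable1_diffP; exact: ex_derive.
have [t] := MVT ltr01 (fun t _ => dphi t) cphi.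
rewrite in_itv/= => /andP[/ltW t0 /ltW t1] e; exists t; first by rewrite t0 t1.
move: e; rewrite subr0 mulr1 => <-.
by rewrite /phi !scale1r !scale0r !addr0 !(addrC y) !(addrC y') !subrK; ring.
Qed.

Lemma d_entry_le j0 (x h : 'rV[R]_k) i j : is_Cb j0.+1 N g ->
  `|('d g x h) i j| <= Cb_norm j0.+1 N g * \sum_l `|h 0 l|.
Proof.
move=> gC; rewrite frechetE mulr_sumr; apply: (le_trans (ler_norm_sum _ _ _)).
apply: ler_sum => l _; rewrite normrM mulrC; apply: ler_wpM2r => //.
have eN' := entry_norm_lin_opnorm k eN.
apply: le_trans (Cb_norm_frechet_le eN gC).
by apply: Cb_entry_le => //; case: gC => _ _ [].
Qed.

Lemma Cb_lipschitz j0 (x y : 'rV[R]_k) i j : is_Cb j0.+1 N g ->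
  `|g x i j - g y i j| <= Cb_norm j0.+1 N g * dist1 x y.
Proof.
move=> gC; have dg : forall z, differentiable g z by case: gC => _ _ [].
have [t _ e] := line_mvt x y 0 0 i j dg.
have z0 z : ('d g z (0 - 0)) i j = 0 by rewrite (subrr (0 : 'rV[R]_k)) linear0 mxE.
rewrite z0 (subrr (g 0 i j)) [LHS]subr0 [RHS]subr0 in e; rewrite e.
apply: (le_trans (d_entry_le _ _ _ _ gC)).
by rewrite /dist1; under eq_bigr do rewrite !mxE.
Qed.

End Increments.

Lemma dist1_ge0 n (x y : 'rV[R]_n) : 0 <= dist1 x y.
Proof. by apply: sumr_ge0. Qed.

(** The mean value theorem is applied at one and the same parameter of the segments
    from [y] to [x] and from [y'] to [x'], so that the two intermediate points are
    close when [x], [x'] and [y], [y'] are. *)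
Lemma Cb2_increment k a b (N : 'M[R]_(a, b) -> R) (g : 'rV[R]_k -> 'M[R]_(a, b))
    (x y x' y' : 'rV[R]_k) i j : entry_norm N -> is_Cb 2 N g ->
  `|g x i j - g y i j - (g x' i j - g y' i j)| <=
    Cb_norm 2 N g * (dist1 (x - x') (y - y') +
                     (dist1 x x' + dist1 y y') * dist1 x' y').
Proof.
move=> eN gC; have dg : forall z, differentiable g z by case: gC => _ _ [].
have [t /andP[t0 t1] ->] := line_mvt x y x' y' i j dg.
set z := y + _; set z' := y' + _; rewrite !frechetE -sumrB.
have eN' := entry_norm_lin_opnorm k eN.
have fC : is_Cb 1 (lin_opnorm N) (frechet g) by case: gC => _ _ [].
have cb l : `|frechet g z l (mxvec_index i j)| <= Cb_norm 2 N g.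
  by apply: le_trans (Cb_norm_frechet_le eN gC); exact: Cb_entry_le.
have zz : dist1 z z' <= dist1 x x' + dist1 y y'.
  rewrite -big_split; apply: ler_sum => l _; rewrite !mxE /=.
  rewrite (_ : _ - _ = t * (x 0 l - x' 0 l) + (1 - t) * (y 0 l - y' 0 l)); last by ring.
  apply: (le_trans (ler_normD _ _)); rewrite !normrM (ger0_norm t0) (@ger0_norm _ (1 - t)) ?subr_ge0//.
  by apply: lerD; apply: ler_piMl; rewrite ?gerBl.
have cc l : `|frechet g z l (mxvec_index i j) - frechet g z' l (mxvec_index i j)|
    <= Cb_norm 2 N g * (dist1 x x' + dist1 y y').
  apply: (le_trans (Cb_lipschitz eN' _ _ _ _ fC)); apply: ler_pM => //.
  - exact: Cb_norm_ge0.
  - exact: dist1_ge0.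
  - exact: Cb_norm_frechet_le.
have C0 := Cb_norm_ge0 eN gC.
rewrite mulrDr mulrA /dist1 !mulr_sumr -big_split.
apply: (le_trans (ler_norm_sum _ _ _)); apply: ler_sum => l _.
move: (cb l) (cc l).
generalize (frechet g z l (mxvec_index i j)) (frechet g z' l (mxvec_index i j)) => c c' bc bcc.
rewrite !subr_mx_entry.
rewrite (_ : _ - _ = (x 0 l - x' 0 l - (y 0 l - y' 0 l)) * c
  + (x' 0 l - y' 0 l) * (c - c')); last by ring.
apply: (le_trans (ler_normD _ _)); rewrite !normrM.
by apply: lerD; rewrite mulrC; apply: ler_wpM2r.
Qed.

End MeanValue.

(** * From short to long intervals *)

Section Propagation.
Context {R : realType}.
Implicit Types (p v : R) (I : interval R) (Z : R -> R).

Lemma powR_add_le p (x y : R) : 1 <= p -> 0 <= x -> 0 <= y ->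
  (x + y) `^ p <= 2 `^ p * (x `^ p + y `^ p).
Proof.
move=> p1 x0 y0; have := @powR_sum_le R bool p (fun b => if b then x else y) p1.
by rewrite card_bool !big_bool; apply; case.
Qed.

Lemma le_addeps (x y : R) : (forall e, 0 < e -> x <= y + e) -> x <= y.
Proof.
move=> H; rewrite leNgt; apply/negP => yx.
by have := H ((x - y) / 2); rewrite divr_gt0 ?subr_gt0// => /(_ isT); lra.
Qed.

Lemma bvar_concat p (a c b v : R) Z : 1 <= p -> 0 <= v -> a <= c -> c <= b ->
  bvar p `[a, c] Z v -> bvar p `[c, b] Z v -> bvar p `[a, b] Z (4 * v).
Proof.
move=> p1 v0 ac cb /(bvar_control v0)[W1 [ZW1 W1v]] /(bvar_control v0)[W2 [ZW2 W2v]].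
have p0 : 0 < p by apply: lt_le_trans p1.
pose W t := 2 `^ p * (if t <= c then W1 t else W1 c + (W2 t - W2 c)).
have c1 : c \in `[a, c] by rewrite in_itv/= ac lexx.
have c2 : c \in `[c, b] by rewrite in_itv/= cb lexx.
have two1 : 1 <= 2 `^ p :> R.
  by apply: (le_trans _ (le1r_powR _ p1)); rewrite ler1n.
have incr0 s t : 0 <= incr p Z s t by exact: powR_ge0.
have scale x y : 0 <= x -> x <= y -> x <= 2 `^ p * y.
  by move=> x0 xy; apply: (le_trans xy); rewrite ler_peMl// (le_trans x0).
apply: (@bvar_of_control _ _ _ _ W _ 0) => //; first by rewrite mulr_ge0.
  move=> s t; rewrite !in_itv/= => /andP[as_ sb] /andP[at_ tb] st.
  rewrite /W -mulrBr; have [tc|ct] := leP t c; have [sc|cs] := leP s c.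
  - by apply: scale => //; apply: ZW1; rewrite // in_itv/= ?as_ ?at_.
  - by have := lt_le_trans cs (le_trans st tc); rewrite ltxx.
  - have h1 : incr p Z s c <= W1 c - W1 s by apply: ZW1; rewrite // in_itv/= as_.
    have h2 : incr p Z c t <= W2 t - W2 c.
      by apply: ZW2; rewrite // ?in_itv/= ?tb ?(ltW ct).
    apply: (@le_trans _ _ (2 `^ p * (incr p Z c t + incr p Z s c))).
      apply: le_trans (powR_add_le p1 (normr_ge0 _) (normr_ge0 _)).
      rewrite /incr; apply: le_powR => //; first exact: ltW.
      by apply: le_trans (ler_normD _ _); rewrite addrA subrK.
    by apply: ler_wpM2l; [exact: powR_ge0|lra].
  - rewrite [X in _ * X](_ : _ = W2 t - W2 s); last by ring.
    by apply: scale => //; apply: ZW2; rewrite // in_itv/= ?sb ?tb ltW.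
move=> t; rewrite in_itv/= => /andP[at_ tb]; rewrite add0r /W.
have /andP[h1 h2] := W1v c c1; have /andP[h3 h4] := W2v c c2.
rewrite (_ : 4 * v = 2 * (2 * v)); last by ring.
rewrite (powRM p (ler0n _ 2) (mulr_ge0 (ler0n _ 2) v0)).
have h5 : v `^ p + v `^ p <= (2 * v) `^ p.
  by rewrite mulr_natl mulr2n; exact: powR_superadd.
have v0p : 0 <= v `^ p by exact: powR_ge0.
have [tc|ct] := leP t c.
  have /andP[h6 h7] : 0 <= W1 t <= v `^ p by apply: W1v; rewrite in_itv/= at_.
  by rewrite mulr_ge0 ?powR_ge0//=; apply: ler_wpM2l; [exact: powR_ge0|lra].
have /andP[h6 h7] : 0 <= W2 t <= v `^ p by apply: W2v; rewrite in_itv/= tb ltW.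
have h8 : incr p Z c t <= W2 t - W2 c by apply: ZW2; rewrite // ?in_itv/= ?tb ?(ltW ct).
have := incr0 c t => h9.
rewrite mulr_ge0 ?powR_ge0//=; last by lra.
by apply: ler_wpM2l; [exact: powR_ge0|lra].
Qed.

(** A right-continuous path does not jump when it leaves [c]. *)
Lemma bvar_right_closure p (c b v : R) Z : 1 <= p -> 0 <= v ->
  (forall e, 0 < e -> exists2 d, c < d & forall x, c < x <= d -> `|Z x - Z c| <= e) ->
  bvar p `]c, b] Z v -> bvar p `[c, b] Z v.
Proof.
move=> p1 v0 rc /(bvar_control v0)[W [ZW Wv]].
have p0 : 0 < p by apply: lt_le_trans p1.
apply: (@bvar_of_control _ _ _ _ (fun t => if t <= c then 0 else W t) _ 0) => //; last first.
  move=> t; rewrite in_itv/= add0r => /andP[ct tb].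
  have [tc|tc] := leP t c; first by rewrite lexx powR_ge0.
  by apply: Wv; rewrite in_itv/= tc.
move=> s t; rewrite !in_itv/= => /andP[cs sb] /andP[ct tb] st.
have [tc|ct'] := leP t c; have [sc|cs'] := leP s c.
- have -> : s = t by apply/eqP; rewrite eq_le st (le_trans tc cs).
  by rewrite incrxx ?subrr// gt_eqF.
- by have := lt_le_trans cs' (le_trans st tc); rewrite ltxx.
- have -> : s = c by apply/eqP; rewrite eq_le sc cs.
  have tI : t \in `]c, b] by rewrite in_itv/= ct'.
  have /andP[Wt0 _] := Wv t tI.
  rewrite subr0 -(@powRVK _ p (W t)) ?gt_eqF//; apply: le_powR => //; first exact: ltW.
  apply: le_addeps => e e0; have [d cd hd] := rc e e0.
  have xd : c < Num.min d t <= d by rewrite lt_min cd ct' ge_min lexx.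
  have xI : Num.min d t \in `]c, b].
    by rewrite in_itv/= lt_min cd ct' ge_min tb orbT.
  rewrite -[Z t - Z c](subrK (Z t - Z (Num.min d t))) addrC.
  apply: (le_trans (ler_normD _ _)); apply: lerD; last first.
    by rewrite opprB addrC addrA subrK; exact: hd.
  apply: (@powR_le_inv _ p) => //; first exact: powR_ge0.
  rewrite powRVK ?gt_eqF//; apply: le_trans (ZW _ _ xI tI _) _; first by rewrite ge_min lexx orbT.
  by have /andP[h _] := Wv _ xI; rewrite gerBl.
- by apply: ZW; rewrite // in_itv/= ?cs' ?ct'.
Qed.

Section System.
Variables (K : finType) (p r : R).
Hypotheses (p1 : 1 <= p) (r0 : 0 < r).
Implicit Types D : K -> R -> R.

Definition vbvar I D v := forall k, bvar p I (D k) v.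

Definition vnorm D a : R := \sum_k `|D k a|.

Definition right_cont D c := forall e : R, 0 < e ->
  exists2 d, c < d & forall k x, c < x <= d -> `|D k x - D k c| <= e.

(** To absorb [v / 2] into [v] one needs the best bound rather than just some bound. *)
Lemma vbvar_least I D v : 0 <= v -> vbvar I D v ->
  exists v0, [/\ 0 <= v0, vbvar I D v0 & forall w, 0 <= w -> vbvar I D w -> v0 <= w].
Proof.
move=> v0 Dv; pose S : set R := fun w => 0 <= w /\ vbvar I D w.
have lb : lbound S 0 by move=> w [].
have hS : has_inf S by split; [exists v|exists 0].
have p0 : 0 < p by apply: lt_le_trans p1.
exists (inf S); split.
- by apply: lb_le_inf => //; exists v.
- move=> k s l c; have s0 : 0 <= psum (incr p (D k)) s l.
    by apply: psum_ge0 c => *; exact: powR_ge0.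
  rewrite -(@powRVK _ p (psum _ _ _)) ?gt_eqF//; apply: le_powR; first exact: ltW.
    exact: powR_ge0.
  apply: lb_le_inf; first by exists v.
  move=> w [w0 Dw]; apply: (@powR_le_inv _ p) => //; first exact: powR_ge0.
  by rewrite powRVK ?gt_eqF//; exact: Dw.
- by move=> w w0 Dw; apply: ge_inf; [exists 0|].
Qed.

Lemma vnorm_ge0 D a : 0 <= vnorm D a.
Proof. exact: sumr_ge0. Qed.

Lemma vnorm_le D v I a b : 0 <= v -> vbvar I D v -> a \in I -> b \in I ->
  vnorm D b <= vnorm D a + #|K|%:R * v.
Proof.
move=> v0 Dv aI bI; rewrite mulr_natl -sumr_const -big_split.
apply: ler_sum => k _; rewrite -{1}[D k b](subrK (D k a)) addrC.
apply: (le_trans (ler_normD _ _)); rewrite lerD2l.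
by apply: bvar_incr (Dv k) _ _ => //; apply: lt_le_trans p1.
Qed.

Variables (C0 lam Mw : R).
Hypotheses (C00 : 0 <= C0) (lam0 : 0 <= lam) (Mw0 : 0 <= Mw).

(** Below this size of the control the factor in front of [v] is at most [1 / 2]. *)
Let eps := ((2 * (C0 + 1))^-1) `^ r^-1.

Let C1 := C0 + 2 * C0 * C0 * Mw `^ r.

(** One more short interval multiplies the starting value by at most
    [1 + lam * (#|K| * C1)]; the factor [4] is lost in [bvar_concat]. *)
Fixpoint propagation_const N : R :=
  if N is N'.+1 then 4 * (C1 + propagation_const N' * (1 + lam * (#|K|%:R * C1)))
  else C1.

Let C10 : 0 <= C1.
Proof. by rewrite addr_ge0// !mulr_ge0// powR_ge0. Qed.

Let propagation_const_ge N : C1 <= propagation_const N.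
Proof.
elim: N => [//|N IH] /=.
apply: (@le_trans _ _ (4 * C1)); first by have := C10; lra.
rewrite ler_pM2l// lerDl mulr_ge0 ?addr_ge0 ?mulr_ge0//; exact: le_trans IH.
Qed.

Let eps0 : 0 < eps.
Proof. by rewrite powR_gt0// invr_gt0 mulr_gt0// ltr_wpDl. Qed.

Let epsC : C0 * eps `^ r <= 1 / 2.
Proof.
have c1 : 0 < C0 + 1 by rewrite ltr_wpDl.
rewrite powRVK ?gt_eqF ?invr_ge0 ?mulr_ge0 ?(ltW c1)//.
by rewrite ler_pdivrMr ?mulr_gt0//; lra.
Qed.

Section Path.
Variables (T B : R) (D : K -> R -> R) (Om : R -> R).
Hypothesis B0 : 0 <= B.
Hypothesis Om_mono : forall s t, 0 <= s -> s <= t -> t <= T -> Om s <= Om t.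
Hypothesis OmM : forall s t, 0 <= s -> s <= t -> t <= T -> Om t - Om s <= Mw.
Hypothesis D_rc : forall c, 0 <= c < T -> right_cont D c.
Hypothesis D_fin : exists2 v, 0 <= v & vbvar `[0, T] D v.
(** The bound [v] is only asked for before the end [b], where the driving path may
    have a large jump. *)
Hypothesis step : forall a b v, 0 <= a -> a <= b -> b <= T -> 0 <= v ->
  vbvar `[a, b[ D v ->
  vbvar `[a, b] D (C0 * (lam * vnorm D a + B) + C0 * v * (Om b - Om a) `^ r).

Let E a := lam * vnorm D a + B.

Let E0 a : 0 <= E a.
Proof. by rewrite addr_ge0// mulr_ge0// vnorm_ge0. Qed.

Let small_closed a c : 0 <= a -> a <= c -> c <= T -> Om c - Om a <= eps ->
  vbvar `[a, c] D (2 * C0 * E a).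
Proof.
move=> a0 ac cT small; have [w w0 Dw] := D_fin.
have Dac : vbvar `[a, c] D w.
  move=> k; apply: bvar_sub (Dw k) => x; rewrite !in_itv/= => /andP[ax xc].
  by rewrite (le_trans a0)//= (le_trans xc).
have [v [v0 Dv vmin]] := vbvar_least w0 Dac.
have e0 : 0 <= (Om c - Om a) `^ r by exact: powR_ge0.
have e1 : C0 * (Om c - Om a) `^ r <= 1 / 2.
  apply: le_trans epsC; apply: ler_wpM2l => //; apply: le_powR => //; first exact: ltW.
  by rewrite subr_ge0 Om_mono.
have Dv' : vbvar `[a, c[ D v.
  move=> k; apply: bvar_sub (Dv k) => x; rewrite !in_itv/= => /andP[-> xc].
  exact: ltW.
have := step a0 ac cT v0 Dv' => /vmin; rewrite -/(E a) => h.
have h1 : 0 <= C0 * E a by rewrite mulr_ge0.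
have h2 : 0 <= C0 * v * (Om c - Om a) `^ r by rewrite !mulr_ge0.
have h3 : v * (C0 * (Om c - Om a) `^ r) <= v * (1 / 2) by apply: ler_wpM2l.
move=> k; apply: bvar_le (Dv k) => //; first by apply: le_trans p1.
by have := h (addr_ge0 h1 h2); lra.
Qed.

(** The control of the closed interval may be large because of a jump at [b]. It
    enters a single time, through a second use of [step], and is not absorbed. *)
Let small_half_open a b : 0 <= a -> a <= b -> b <= T ->
  (forall c, a <= c < b -> Om c - Om a <= eps) ->
  vbvar `[a, b] D (C1 * E a).
Proof.
move=> a0 ab bT small.
have half : vbvar `[a, b[ D (2 * C0 * E a).
  move=> k s l c; have sI := chain_mem_last c.
  move: (sI); rewrite in_itv/= => /andP[au ub].
  have := @small_closed a (last s l) a0 au (le_trans (ltW ub) bT) (small _ sI) k s l.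
  apply; case/andP: (c) => ps _; rewrite /chain ps; apply/allP => x xl.
  rewrite in_itv/=; have /andP[_ ->] := chain_bounds c xl.
  by have := chain_mem c xl; rewrite in_itv/= => /andP[-> _].
have v0 : 0 <= 2 * C0 * E a by rewrite !mulr_ge0.
have := step a0 ab bT v0 half => h k; apply: bvar_le (h k); first by apply: le_trans p1.
  by rewrite addr_ge0 ?mulr_ge0 ?powR_ge0//; exact: E0.
rewrite -/(E a) (_ : C1 * E a = C0 * E a + C0 * (2 * C0 * E a) * Mw `^ r); last by rewrite /C1; ring.
rewrite lerD2l.
apply: ler_wpM2l; first by rewrite mulr_ge0.
by apply: le_powR; [exact: ltW|rewrite subr_ge0 Om_mono|exact: OmM].
Qed.

(** The interval is cut at the last time [tau] up to which the control stays below
    [eps]. Beyond any later time [x] one unit [eps] of control is used up, whence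
    the induction; the remaining interval is reached by letting [x] decrease to
    [tau]. *)
Let propagation N a b : 0 <= a -> a <= b -> b <= T ->
  Om b - Om a <= N.+1%:R * eps -> vbvar `[a, b] D (propagation_const N * E a).
Proof.
elim: N a b => [|N IH] a b a0 ab bT ON.
  apply: small_half_open => // c /andP[ac cb]; rewrite mul1r in ON.
  apply: le_trans ON; rewrite lerB// Om_mono ?(ltW cb)//; exact: le_trans ac.
pose S : set R := fun c => a <= c <= b /\ Om c - Om a <= eps.
have Sa : S a by split; [rewrite lexx|rewrite subrr ltW].
have Sub : ubound S b by move=> c [/andP[]].
have Ssup : has_sup S by split; [exists a|exists b].
pose tau := sup S.
have atau : a <= tau by apply: ub_le_sup => //; exists b.
have taub : tau <= b by apply: ge_sup => //; exists a.
have tauT := le_trans taub bT; have tau0 := le_trans a0 atau.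
have left_part : vbvar `[a, tau] D (C1 * E a).
  apply: small_half_open => // c /andP[ac ct].
  have tc0 : 0 < tau - c by rewrite subr_gt0.
  have [u [/andP[au ub] uS] cu] := sup_adherent tc0 Ssup.
  apply: le_trans uS; rewrite lerD2r Om_mono ?(le_trans a0)//.
    by move: cu; rewrite -/tau opprB addrC subrK => /ltW.
  exact: le_trans bT.
have CE0 : 0 <= C1 * E a by rewrite mulr_ge0.
have Etau : E tau <= (1 + lam * (#|K|%:R * C1)) * E a.
  have := vnorm_le (a := a) (b := tau) CE0 left_part.
  rewrite !in_itv/= !lexx atau => /(_ isT isT) h; have := ler_wpM2l lam0 h.
  by rewrite /E; lra.
have CN0 : 0 <= propagation_const N by apply: le_trans (propagation_const_ge N).
have k0 : 0 <= 1 + lam * (#|K|%:R * C1) by rewrite addr_ge0// !mulr_ge0.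
have V0 : 0 <= (C1 + propagation_const N * (1 + lam * (#|K|%:R * C1))) * E a.
  by rewrite mulr_ge0// addr_ge0// mulr_ge0.
have [tb|tb] := eqVneq tau b.
  rewrite tb in left_part; move=> k; apply: bvar_le (left_part k) => //.
    by apply: le_trans p1.
  by apply: ler_wpM2r => //; exact: (propagation_const_ge N.+1).
have {}tb : tau < b by rewrite lt_neqAle tb.
have tI : 0 <= tau < T by rewrite tau0; exact: lt_le_trans bT.
have rc := D_rc tI.
have right_part : vbvar `[tau, b] D (propagation_const N * E tau).
  move=> k; apply: bvar_right_closure => //; first by rewrite mulr_ge0.
    by move=> e /rc[d cd h]; exists d => // x; exact: h.
  move=> s l c; have := chain_mem c (mem_head s l); rewrite in_itv/= => /andP[ts sb].
  have p0 : 0 < p by apply: lt_le_trans p1.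
  have s0 : 0 <= psum (incr p (D k)) s l.
    by apply: psum_ge0 c => *; exact: powR_ge0.
  rewrite -(@powRVK _ p (psum _ _ _)) ?gt_eqF//; apply: le_powR; rewrite ?powR_ge0 ?(ltW p0)//.
  pose Cn := propagation_const N * (lam * #|K|%:R) + 1.
  have Cn0 : 0 < Cn by rewrite ltr_wpDl// !mulr_ge0.
  apply: le_addeps => e e0; have [d cd h] := rc (e / Cn) (divr_gt0 e0 Cn0).
  pose x := Num.min d s.
  have tx : tau < x by rewrite lt_min cd ts.
  have xs : x <= s by rewrite ge_min lexx orbT.
  have xd : x <= d by rewrite ge_min lexx.
  have xb := le_trans xs sb.
  have x0 := le_trans tau0 (ltW tx).
  have Ox : Om b - Om x <= N.+1%:R * eps.
    have nS : eps < Om x - Om a.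
      rewrite ltNge; apply/negP => le; have : x <= tau.
        by apply: ub_le_sup; [exists b|split=> //; rewrite xb (le_trans atau)// ltW].
      by rewrite leNgt tx.
    move: ON; rewrite -[N.+2%:R]natr1 mulrDl mul1r; lra.
  have cx : chain `[x, b] s l.
    case/andP: (c) => ps _; rewrite /chain ps; apply/allP => y ys.
    have /andP[sy _] := chain_bounds c ys.
    by have := chain_mem c ys; rewrite !in_itv/= (le_trans xs sy) => /andP[_ ->].
  have Ex : E x <= E tau + lam * (#|K|%:R * (e / Cn)).
    have : vnorm D x <= vnorm D tau + #|K|%:R * (e / Cn).
      rewrite mulr_natl -sumr_const -big_split; apply: ler_sum => i _.
      rewrite -{1}[D i x](subrK (D i tau)) addrC; apply: (le_trans (ler_normD _ _)).
      by rewrite lerD2l; apply: h; rewrite tx.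
    by move/(ler_wpM2l lam0); rewrite /E; lra.
  apply: (@powR_le_inv _ p) => //; first exact: powR_ge0.
    by rewrite addr_ge0 ?mulr_ge0// ltW.
  rewrite powRVK ?gt_eqF//; apply: (le_trans (IH x b x0 xb bT Ox k s l cx)).
  apply: le_powR; [exact: ltW|by rewrite mulr_ge0|].
  apply: (le_trans (ler_wpM2l CN0 Ex)); rewrite mulrDr lerD2l.
  rewrite [leLHS](_ : _ = propagation_const N * (lam * #|K|%:R) * (e / Cn)); last by ring.
  apply: (@le_trans _ _ (Cn * (e / Cn))); last by rewrite mulrC divfK// gt_eqF.
  by apply: ler_wpM2r; [rewrite divr_ge0// ltW|rewrite lerDl].
have EV : 0 <= C1 * E a + propagation_const N * E tau by rewrite addr_ge0// mulr_ge0.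
move=> k; apply: (@bvar_le _ _ _ _ (4 * (C1 * E a + propagation_const N * E tau))).
- by apply: le_trans p1.
- by rewrite mulr_ge0.
- by have := ler_wpM2l CN0 Etau; rewrite /=; lra.
apply: (@bvar_concat _ _ tau) => //.
- apply: bvar_le (left_part k); rewrite ?lerDl ?mulr_ge0//; exact: le_trans p1.
- apply: bvar_le (right_part k); rewrite ?lerDr ?mulr_ge0//; exact: le_trans p1.
Qed.

Lemma propagation_path N : 0 <= T -> Mw <= N.+1%:R * eps ->
  vbvar `[0, T] D (propagation_const N * (lam * vnorm D 0 + B)).
Proof.
by move=> T0 NM; apply: propagation => //; apply: le_trans NM; exact: OmM.
Qed.

End Path.

Lemma propagation_bound : exists2 C : R, 0 <= C &
  forall (T B : R) (D : K -> R -> R) (Om : R -> R), 0 <= T -> 0 <= B ->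
  (forall s t, 0 <= s -> s <= t -> t <= T -> Om s <= Om t) ->
  (forall s t, 0 <= s -> s <= t -> t <= T -> Om t - Om s <= Mw) ->
  (forall c, 0 <= c < T -> right_cont D c) ->
  (exists2 v, 0 <= v & vbvar `[0, T] D v) ->
  (forall a b v, 0 <= a -> a <= b -> b <= T -> 0 <= v -> vbvar `[a, b[ D v ->
    vbvar `[a, b] D (C0 * (lam * vnorm D a + B) + C0 * v * (Om b - Om a) `^ r)) ->
  vbvar `[0, T] D (C * (lam * vnorm D 0 + B)).
Proof.
pose N := Num.bound (Mw / eps).
have NM : Mw <= N.+1%:R * eps.
  rewrite -ler_pdivrMr//; apply: ltW; apply: (@lt_le_trans _ _ N%:R).
    by apply: archi_boundP; rewrite divr_ge0// ltW.
  by rewrite ler_nat.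
exists (propagation_const N); first exact: le_trans (propagation_const_ge N).
by move=> T B D Om T0 B0 h1 h2 h3 h4 h5; exact: (propagation_path B0 h1 h2 h3 h4 h5).
Qed.

End System.
End Propagation.

(** * Partitions, Riemann sums and vector-valued paths *)

Section Partitions.
Context {R : realType}.
Implicit Types (s t v : R) (l : seq R).

Lemma sum_part_pt_cons (V : zmodType) (phi : R -> R -> V) s t u l :
  \sum_(0 <= k < (size l).+1) phi (part_pt s t (u :: l) k) (part_pt s t (u :: l) k.+1) =
  phi s u + \sum_(0 <= k < size l) phi (part_pt u t l k) (part_pt u t l k.+1).
Proof. by rewrite big_nat_recl. Qed.

Lemma rvar_sumE n p s t (Z : R -> 'rV[R]_n) l :
  rvar_sum p s t Z l = psum (fun x y => eucl (Z y - Z x) `^ p) s l.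
Proof.
rewrite /rvar_sum; elim: l s => [|u l IH] s; first by rewrite big_geq.
by rewrite (sum_part_pt_cons (fun x y => eucl (Z y - Z x) `^ p)) IH.
Qed.

Lemma riemann_sumE d n s t (H : R -> 'M[R]_(d, n)) (A : R -> 'rV[R]_d) l j :
  riemann_sum s t H A l 0 j =
  \sum_i rs (fun x => H x i j) (fun x => A x 0 i) s l.
Proof.
rewrite /riemann_sum; elim: l s => [|u l IH] s.
  by rewrite big_geq// mxE big1.
rewrite (sum_part_pt_cons (fun x y => (A y - A x) *m H x)) mxE IH.
rewrite mxE -big_split; apply: eq_bigr => i _ /=.
by rewrite !mxE /rs /= mulrC.
Qed.

Definition mesh_lt (e : R) s l := path (fun x y => y - x < e) s l.

Lemma mesh_ltP e s t l : mesh_lt e s l ->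
  forall k, (k < size l)%N -> part_pt s t l k.+1 - part_pt s t l k < e.
Proof. by move/(pathP t). Qed.

Lemma fine_partition_exists (e s t : R) : 0 < e -> s <= t ->
  exists l, [/\ path <%R s l, last s l = t & mesh_lt e s l].
Proof.
move=> e0 st; have [N hN] : exists N : nat, t - s <= N%:R * (e / 2).
  exists (Num.bound ((t - s) / (e / 2))); rewrite -ler_pdivrMr ?divr_gt0//.
  by apply/ltW/archi_boundP; rewrite divr_ge0 ?subr_ge0// divr_ge0// ltW.
elim: N s st hN => [|N IH] s st hN.
  by exists [::]; split => //=; apply/eqP; rewrite eq_le st -subr_le0 (le_trans hN)// mul0r.
have [small|big] := leP (t - s) (e / 2).
  move: st; rewrite le_eqVlt => /predU1P[->|st]; first by exists [::].
  by exists [:: t]; rewrite /mesh_lt/= st; split => //; rewrite andbT; lra.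
have [||l [pl ll ml]] := IH (s + e / 2); first by lra.
  by move: hN; rewrite -[N.+1%:R]natr1; lra.
exists (s + e / 2 :: l); split=> //=; first by rewrite pl ltrDl divr_gt0.
by rewrite /mesh_lt /= -/(mesh_lt _ _ _) ml andbT; lra.
Qed.

Lemma partition_itv s t l : path <%R s l -> last s l = t -> itv_partition s t l.
Proof. by move=> pl <-; split. Qed.

(** Prepending one fine partition of the interval from [0] to [s] turns Riemann sums
    from [s] to [t] into Riemann sums from [0] to [t]. *)
Lemma young_increment d n s t (H : R -> 'M[R]_(d, n)) (A : R -> 'rV[R]_d) (Is It : 'rV[R]_n) :
  0 <= s -> s <= t -> is_young_integral 0 s H A Is -> is_young_integral 0 t H A It ->
  forall e : R, 0 < e -> exists2 delta : R, 0 < delta &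
    forall l, path <%R s l -> last s l = t -> mesh_lt delta s l ->
    forall j, `|\sum_i rs (fun x => H x i j) (fun x => A x 0 i) s l - (It 0 j - Is 0 j)| <= e.
Proof.
move=> s0 st hs ht e e0; have e2 : 0 < e / 2 by rewrite divr_gt0.
have [d1 d10 h1] := hs _ e2; have [d2 d20 h2] := ht _ e2.
exists d2 => // l pl ll ml j.
have m0 : 0 < Num.min d1 d2 by rewrite lt_min d10.
have [l0 [p0 ll0 ml0]] := fine_partition_exists m0 s0.
have ml01 : mesh_lt d1 0 l0.
  by apply: sub_path ml0 => x y /lt_le_trans; apply; rewrite ge_min lexx.
have ml02 : mesh_lt d2 0 l0.
  by apply: sub_path ml0 => x y /lt_le_trans; apply; rewrite ge_min lexx orbT.
have a1 := h1 l0 (partition_itv p0 ll0) (mesh_ltP s ml01).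
have a2 : eucl (riemann_sum 0 t H A (l0 ++ l) - It) < e / 2.
  apply: h2; last by apply: mesh_ltP; rewrite /mesh_lt cat_path ll0; apply/andP.
  by apply: partition_itv; [rewrite cat_path p0 ll0|rewrite last_cat ll0].
have b1 := le_lt_trans (coord_le_eucl _ j) a1.
have b2 := le_lt_trans (coord_le_eucl _ j) a2.
have E : riemann_sum 0 t H A (l0 ++ l) 0 j =
    riemann_sum 0 s H A l0 0 j + \sum_i rs (fun x => H x i j) (fun x => A x 0 i) s l.
  rewrite !riemann_sumE -big_split; apply: eq_bigr => i _.
  by rewrite /rs psum_cat ll0.
move: b1 b2; rewrite !subr_mx_entry E => b1 b2.
rewrite [X in `|X|](_ : _ = (riemann_sum 0 s H A l0 0 j + \sum_i rs (fun x => H x i j) (fun x => A x 0 i) s l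
   - It 0 j) - (riemann_sum 0 s H A l0 0 j - Is 0 j)); last by ring.
by apply: (le_trans (ler_normB _ _)); lra.
Qed.

(** Both integrals are approximated along the same partition, so that bounds on
    differences of Riemann sums carry over. *)
Lemma young_increment_le d n s t (H H' : R -> 'M[R]_(d, n)) (A A' : R -> 'rV[R]_d)
    (Is It Is' It' : 'rV[R]_n) j (v : R) :
  0 <= s -> s <= t -> is_young_integral 0 s H A Is -> is_young_integral 0 t H A It ->
  is_young_integral 0 s H' A' Is' -> is_young_integral 0 t H' A' It' ->
  (forall l, path <%R s l -> last s l = t ->
    `|\sum_i (rs (fun x => H x i j) (fun x => A x 0 i) s l
       - rs (fun x => H' x i j) (fun x => A' x 0 i) s l)| <= v) ->
  `|(It 0 j - Is 0 j) - (It' 0 j - Is' 0 j)| <= v.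
Proof.
move=> s0 st hs ht hs' ht' hv; apply: le_addeps => e e0.
have e2 : 0 < e / 2 by rewrite divr_gt0.
have [d1 d10 h1] := young_increment s0 st hs ht e2.
have [d2 d20 h2] := young_increment s0 st hs' ht' e2.
have m0 : 0 < Num.min d1 d2 by rewrite lt_min d10.
have [l [pl ll ml]] := fine_partition_exists m0 st.
have ml1 : mesh_lt d1 s l.
  by apply: sub_path ml => x y /lt_le_trans; apply; rewrite ge_min lexx.
have ml2 : mesh_lt d2 s l.
  by apply: sub_path ml => x y /lt_le_trans; apply; rewrite ge_min lexx orbT.
have := h1 l pl ll ml1 j; have := h2 l pl ll ml2 j; have := hv l pl ll.
rewrite sumrB; set S := \sum_i _; set S' := \sum_i _ => a b c.
rewrite [X in `|X|](_ : _ = (S - S') + ((S' - (It' 0 j - Is' 0 j)) - (S - (It 0 j - Is 0 j)))); last by ring.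
apply: (le_trans (ler_normD _ _)); apply: lerD => //.
by apply: (le_trans (ler_normB _ _)); lra.
Qed.

Lemma young_integral0 d n t (A : R -> 'rV[R]_d) :
  is_young_integral 0 t (fun=> 0 : 'M[R]_(d, n)) A 0.
Proof.
move=> e e0; exists 1 => // l _ _.
rewrite /riemann_sum big1 ?subrr ?eucl0// => k _; exact: mulmx0.
Qed.

Lemma young_bvar p q a b (H A WA : R -> R) hv s t l :
  1 <= p -> 1 <= q -> 1 < p^-1 + q^-1 -> 0 <= hv -> bvar p `[a, b[ H hv ->
  (forall x y, x \in `[a, b] -> y \in `[a, b] -> x <= y -> incr q A x y <= WA y - WA x) ->
  a <= s -> t <= b -> path <%R s l -> last s l = t ->
  `|rs H A s l| <= (`|H s| + zeta_bound (p^-1 + q^-1) * hv) * (WA t - WA s) `^ q^-1.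
Proof.
move=> p1 q1 th hv0 /(bvar_control hv0)[WH [HW WHv]] AW a_s tb pl ll.
have sub x : x \in `[s, t[ -> x \in `[a, b[.
  by rewrite !in_itv/= => /andP[sx xt]; rewrite (le_trans a_s)//= (lt_le_trans xt).
have subc x : x \in `[s, t] -> x \in `[a, b].
  by rewrite !in_itv/= => /andP[sx xt]; rewrite (le_trans a_s)//= (le_trans xt).
apply: (@young_estimate _ p q H A WH WA s t hv) => //.
- exact: lt_le_trans p1.
- exact: lt_le_trans q1.
- by move=> x y /sub xI /sub yI; exact: HW.
- by move=> x /sub; exact: WHv.
- by move=> x y /subc xI /subc yI; exact: AW.
Qed.

Lemma rs_diff (H H' A A' : R -> R) s l :
  rs H A s l - rs H' A' s l =
  rs (fun x => H x - H' x) A s l + rs H' (fun x => A x - A' x) s l.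
Proof.
rewrite /rs; elim: l s => [|u l IH] s /=; first by rewrite subrr addr0.
by rewrite opprD addrACA {}IH; ring.
Qed.

End Partitions.

Section VectorPaths.
Context {R : realType}.
Implicit Types (p v T : R).

Definition comp n (Z : R -> 'rV[R]_n) (i : 'I_n) : R -> R := fun t => Z t 0 i.

Lemma rvar_ge0 n p s t (Z : R -> 'rV[R]_n) : (0 <= rvar p s t Z)%E.
Proof. exact: poweR_ge0. Qed.

Lemma rvar_bvar n p T v (Z : R -> 'rV[R]_n) : 1 <= p -> 0 <= v ->
  (rvar p 0 T Z <= v%:E)%E -> vbvar p `[0, T] (comp Z) v.
Proof.
move=> p1 v0 Zv i s l c; have p0 : 0 < p by apply: lt_le_trans p1.
have sI := chain_mem c (mem_head s l); have lI := chain_mem_last c.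
move: sI lI; rewrite !in_itv/= => /andP[s0 sT] /andP[l0 lT].
pose phi x y : R := eucl (Z y - Z x) `^ p.
have phi0 x : phi x x = 0 by rewrite /phi subrr eucl0 powR0// gt_eqF.
have phi_ge x y : 0 <= phi x y by exact: powR_ge0.
have c' : path <=%R 0 (s :: l ++ [:: T]).
  by rewrite /= s0 cat_path /= lT !andbT; case/andP: c.
have [l' [pl' ll' el']] := chain_strict phi0 c'.
pose S : \bar R := ereal_sup [set (rvar_sum p 0 T Z l)%:E | l in itv_partition 0 T]%classic.
have lS : ((rvar_sum p 0 T Z l')%:E <= S)%E.
  apply: ereal_sup_ubound; exists l' => //.
  by apply: partition_itv => //; rewrite ll' /= last_cat.
have S0 : (0 <= S)%E.
  apply: le_trans lS; rewrite lee_fin rvar_sumE el'.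
  apply: (@psum_ge0 _ `]-oo, +oo[) => //.
  by rewrite /chain c'; apply/allP => x _; rewrite in_itv.
have : ((rvar_sum p 0 T Z l')%:E <= (v `^ p)%:E)%E.
  apply: (le_trans lS).
  rewrite -[S]poweRe1// -[1](@mulVf _ p) ?gt_eqF// poweRrM -poweR_EFin.
  apply: gt0_ler_poweR => //; first exact: ltW.
  - by rewrite in_itv/= leey poweR_ge0.
  - by rewrite in_itv/= leey lee_fin v0.
rewrite lee_fin rvar_sumE el' => /(le_trans _); apply.
rewrite [psum phi 0 _]/psum -/(psum phi) psum_cat.
apply: (@le_trans _ _ (psum phi s l)).
  apply: le_psum c => x y _ _ _; apply: le_powR; rewrite ?(ltW p0)//.
  by rewrite /comp -subr_mx_entry; exact: coord_le_eucl.
rewrite addrCA lerDl; apply: addr_ge0; first exact: phi_ge.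
by apply: addr_ge0; [exact: phi_ge|exact: lexx].
Qed.

Lemma bvar_rvar n p T v (Z : R -> 'rV[R]_n) : 1 <= p -> 0 <= T -> 0 <= v ->
  vbvar p `[0, T] (comp Z) v -> (rvar p 0 T Z <= (n%:R ^+ 2 * v)%:E)%E.
Proof.
move=> p1 T0 v0 Zv; have p0 : 0 < p by apply: lt_le_trans p1.
have V0 : 0 <= n%:R ^+ 2 * v by rewrite mulr_ge0.
have sums l : itv_partition 0 T l -> rvar_sum p 0 T Z l <= (n%:R ^+ 2 * v) `^ p.
  move=> [pl /eqP ll]; rewrite rvar_sumE.
  have c : chain `[0, T] 0 l.
    rewrite /chain (sub_path _ pl); last by move=> ? ? /ltW.
    by apply/allP => x xl; rewrite in_itv/= -ll; exact: path_lt_bounds.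
  apply: (@le_trans _ _ (psum (fun x y => n%:R `^ p * \sum_i incr p (comp Z i) x y) 0 l)).
    apply: le_psum c => x y _ _ _.
    apply: (@le_trans _ _ ((\sum_i `|comp Z i y - comp Z i x|) `^ p)).
      apply: le_powR; rewrite ?(ltW p0) ?eucl_ge0//; apply: (le_trans (eucl_le_sum _)).
      by apply: ler_sum => i _; rewrite subr_mx_entry.
    by rewrite -[n in n%:R]card_ord; exact: powR_sum_le.
  rewrite psumZ psum_sum expr2 -mulrA !powRM ?mulr_ge0//.
  apply: ler_wpM2l; first exact: powR_ge0.
  apply: (@le_trans _ _ (n%:R * v `^ p)).
    by rewrite -[n in n%:R]card_ord mulr_natl -sumr_const; apply: ler_sum => i _; exact: Zv.
  by apply: ler_wpM2r; [exact: powR_ge0|exact: powR_natr_ge].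
pose S : \bar R := ereal_sup [set (rvar_sum p 0 T Z l)%:E | l in itv_partition 0 T]%classic.
have ub : (S <= ((n%:R ^+ 2 * v) `^ p)%:E)%E.
  by apply: ge_ereal_sup => _ [l pl <-]; rewrite lee_fin; exact: sums.
rewrite -[n%:R ^+ 2 * v](@powRK _ p) ?gt_eqF// -poweR_EFin.
have S0 : (0 <= S)%E.
  have [l [pl ll _]] := fine_partition_exists ltr01 T0.
  apply: (@le_trans _ _ (rvar_sum p 0 T Z l)%:E).
    rewrite lee_fin; apply: sumr_ge0 => k _; exact: powR_ge0.
  by apply: ereal_sup_ubound; exists l => //; exact: partition_itv.
apply: gt0_ler_poweR => //; rewrite ?invr_ge0 ?(ltW p0)//; rewrite in_itv/= leey ?andbT//.
by rewrite lee_fin powR_ge0.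
Qed.

Lemma rvar_finP n p T (Z : R -> 'rV[R]_n) : (rvar p 0 T Z < +oo)%E ->
  exists2 v, 0 <= v & rvar p 0 T Z = v%:E.
Proof.
have := rvar_ge0 p 0 T Z; case: (rvar p 0 T Z) => // v; rewrite lee_fin => v0 _.
by exists v.
Qed.

Lemma cadlag_right_cont n T (Z : R -> 'rV[R]_n) c : cadlag T Z -> 0 <= c < T ->
  right_cont (comp Z) c.
Proof.
move=> [rc _] cT e e0.
have /cvg_ballP/(_ e e0) := rc c cT.
move=> [d /= d0 hd]; exists (c + d / 2); first by rewrite ltrDl divr_gt0.
move=> k x /andP[cx xd].
have [_ /(_ 0 k)] : ball (Z c) e (Z x).
  by apply: hd => //=; rewrite ltr0_norm ?subr_lt0//; lra.
by rewrite -ball_normE /= distrC => /ltW.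
Qed.

End VectorPaths.

(** * Estimates for one reflected equation and for a pair *)

Section Assembly.
Context {R : realType}.
Implicit Types (p q s t T v : R).

Lemma bvar_ext p I (Z h : R -> R) v :
  (forall s t, s \in I -> t \in I -> s <= t -> Z t - Z s = h t - h s) ->
  bvar p I h v -> bvar p I Z v.
Proof.
move=> Zh hv s l c; apply: le_trans (hv s l c).
by apply: le_psum c => x y xI yI xy; rewrite /incr Zh.
Qed.

Lemma bvar_cst p I (c v : R) : p != 0 -> bvar p I (fun=> c) v.
Proof.
move=> p0 s l cl; apply: (@le_trans _ _ 0); last exact: powR_ge0.
rewrite -[leRHS](subrr (0 : R)) -(psum_telescope (fun=> 0) s l).
by apply: le_psum cl => x y _ _ _; rewrite /incr subrr normr0 powR0// subrr.
Qed.

(** The level of [reflection_bvar] is [L - u], and its initial gap is the difference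
    of the two distances to the barrier. *)
Lemma reflected_scalar p a b V (u u' L L' k k' : R -> R) : 1 <= p -> 0 <= V ->
  {in `[a, b] &, {homo k : s t / s <= t}} ->
  {in `[a, b] &, {homo k' : s t / s <= t}} ->
  (forall t, t \in `[a, b] -> L t <= u t + k t) ->
  (forall t, t \in `[a, b] -> L' t <= u' t + k' t) ->
  (forall e, 0 < e -> rises `[a, b] e k (fun t => L t - u t)) ->
  (forall e, 0 < e -> rises `[a, b] e k' (fun t => L' t - u' t)) ->
  `|(L a - (u a + k a)) - (L' a - (u' a + k' a))| <= 4 * V ->
  bvar p `[a, b] (fun t => u t - u' t) V -> bvar p `[a, b] (fun t => L t - L' t) V ->
  bvar p `[a, b] (fun t => k t - k' t) (128 * V) /\
  bvar p `[a, b] (fun t => (u t + k t) - (u' t + k' t)) (128 * V).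
Proof.
move=> p1 V0 mk mk' Lk Lk' rk rk' ha bu bL.
have bx : bvar p `[a, b] (fun t => (L t - u t) - (L' t - u' t)) (4 * V).
  apply: (bvar_dom2 p1 V0 _ bL bu) => s t _ _ _.
  rewrite [X in `|X|](_ : _ = ((L t - L' t) - (L s - L' s)) - ((u t - u' t) - (u s - u' s))); last by ring.
  exact: ler_normB.
have bk : bvar p `[a, b] (fun t => k t - k' t) (8 * (4 * V)).
  apply: reflection_bvar rk rk' _ bx => //.
  - by rewrite mulr_ge0.
  - by move=> t /Lk; lra.
  - by move=> t /Lk'; lra.
  - by rewrite [X in `|X|](_ : _ = (L a - (u a + k a)) - (L' a - (u' a + k' a)))//; ring.
have V32 : 0 <= 8 * (4 * V) by rewrite !mulr_ge0.
have p0 : 0 <= p by apply: le_trans p1.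
split; first by apply: bvar_le bk => //; lra.
rewrite (_ : 128 * V = 4 * (8 * (4 * V))); last by ring.
apply: (bvar_dom2 p1 V32 _ _ bk); last by apply: bvar_le bu => //; lra.
move=> s t _ _ _; apply: le_trans (ler_normD _ _).
by rewrite le_eqVlt; apply/orP; left; apply/eqP; congr `|_|; ring.
Qed.

(** The right-hand side has finite [q]-variation, as controls are additive, and [q]
    is the smaller exponent. *)
Lemma bvar_two_controls p q a b (al be : R) (J W1 W2 : R -> R) :
  1 <= q -> q <= p -> 0 <= al -> 0 <= be ->
  (forall s t, a <= s -> s <= t -> t <= b -> W1 s <= W1 t) ->
  (forall s t, a <= s -> s <= t -> t <= b -> W2 s <= W2 t) ->
  (forall s t, a <= s -> s <= t -> t <= b -> `|J t - J s| <=
     al * (W1 t - W1 s) `^ q^-1 + be * (W2 t - W2 s) `^ q^-1) ->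
  bvar p `[a, b] J (2 * (al * (W1 b - W1 a) `^ q^-1 + be * (W2 b - W2 a) `^ q^-1)).
Proof.
move=> q1 qp al0 be0 m1 m2 H; have q0 : 0 < q by apply: lt_le_trans q1.
have term_pow c x : 0 <= c -> 0 <= x -> (c * x `^ q^-1) `^ q = c `^ q * x.
  by move=> c0 x0; rewrite powRM ?powR_ge0// powRVK// gt_eqF.
set S := al * _ + _; have S0 : 0 <= S by rewrite addr_ge0// mulr_ge0// powR_ge0.
apply: (bvar_mono_exp q1 qp); first by rewrite mulr_ge0.
pose W t := 2 `^ q * (al `^ q * W1 t + be `^ q * W2 t).
apply: (@bvar_of_control _ _ _ _ W _ (W a)) => //; first by rewrite mulr_ge0.
  move=> s t; rewrite !in_itv/= => /andP[as_ _] /andP[_ tb] st.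
  have d1 : 0 <= W1 t - W1 s by rewrite subr_ge0 m1.
  have d2 : 0 <= W2 t - W2 s by rewrite subr_ge0 m2.
  apply: (@le_trans _ _ ((al * (W1 t - W1 s) `^ q^-1 + be * (W2 t - W2 s) `^ q^-1) `^ q)).
    by apply: le_powR; [exact: ltW|exact: normr_ge0|exact: H].
  apply: (le_trans (powR_add_le q1 _ _)); rewrite ?mulr_ge0 ?powR_ge0//.
  by rewrite !term_pow// /W; lra.
move=> t; rewrite in_itv/= => /andP[at_ tb].
have ab := le_trans at_ tb.
have e1 : 0 <= W1 t - W1 a by rewrite subr_ge0 m1.
have e2 : 0 <= W2 t - W2 a by rewrite subr_ge0 m2.
have e3 : W1 t - W1 a <= W1 b - W1 a by rewrite lerD2r m1.
have e4 : W2 t - W2 a <= W2 b - W2 a by rewrite lerD2r m2.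
have q2 : 0 <= 2 `^ q :> R by exact: powR_ge0.
have qa : 0 <= al `^ q by exact: powR_ge0.
have qb : 0 <= be `^ q by exact: powR_ge0.
have Wt : W t - W a = 2 `^ q * (al `^ q * (W1 t - W1 a) + be `^ q * (W2 t - W2 a)).
  by rewrite /W; ring.
have Wt0 : 0 <= W t - W a by rewrite Wt mulr_ge0// addr_ge0// mulr_ge0.
rewrite -subr_ge0 Wt0 /= -lerBlDl Wt powRM//.
apply: ler_wpM2l => //.
apply: (@le_trans _ _ (al `^ q * (W1 b - W1 a) + be `^ q * (W2 b - W2 a))).
  by apply: lerD; apply: ler_wpM2l.
rewrite -(term_pow _ _ al0 (le_trans e1 e3)) -(term_pow _ _ be0 (le_trans e2 e4)).
by apply: powR_superadd => //; rewrite mulr_ge0// powR_ge0.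
Qed.

Lemma controls_exist d q T v (A : R -> 'rV[R]_d) : 0 <= v ->
  vbvar q `[0, T] (comp A) v -> exists WA : 'I_d -> R -> R,
    (forall i s t, 0 <= s -> s <= t -> t <= T -> incr q (comp A i) s t <= WA i t - WA i s) /\
    (forall i t, 0 <= t -> t <= T -> 0 <= WA i t <= v `^ q).
Proof.
move=> v0 Av.
have [W HW] := choice (fun i => bvar_control v0 (Av i)).
exists W; split=> [i s t s0 st tT|i t t0 tT].
  by apply: (HW i).1; rewrite // in_itv/= ?s0 ?tT ?(le_trans s0 st) ?(le_trans st tT).
by apply: (HW i).2; rewrite in_itv/= t0.
Qed.

Definition total d (WA : 'I_d -> R -> R) t := \sum_i WA i t.

Section YoungDifference.
Variables (n d : nat) (p q T a b : R).
Hypotheses (q1 : 1 <= q) (qp : q <= p) (th : 1 < p^-1 + q^-1).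
Hypotheses (a0 : 0 <= a) (bT : b <= T).
Variables (H H' : R -> 'M[R]_(d, n)) (A A' : R -> 'rV[R]_d) (J J' : R -> 'rV[R]_n).
Variables (WA WE : 'I_d -> R -> R) (gG hG gH hH : R).
Hypotheses (hG0 : 0 <= hG) (hH0 : 0 <= hH) (gG0 : 0 <= gG) (gH0 : 0 <= gH).
Hypothesis WAP : forall i s t, 0 <= s -> s <= t -> t <= T ->
  incr q (comp A i) s t <= WA i t - WA i s.
Hypothesis WEP : forall i s t, 0 <= s -> s <= t -> t <= T ->
  incr q (fun t => comp A i t - comp A' i t) s t <= WE i t - WE i s.
Hypothesis JP : forall t, 0 <= t <= T -> is_young_integral 0 t H A (J t).
Hypothesis JP' : forall t, 0 <= t <= T -> is_young_integral 0 t H' A' (J' t).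
Hypothesis GP : forall i j, (forall t, t \in `[a, b[ -> `|H t i j - H' t i j| <= gG) /\
  bvar p `[a, b[ (fun t => H t i j - H' t i j) hG.
Hypothesis HP' : forall i j, (forall t, t \in `[a, b[ -> `|H' t i j| <= gH) /\
  bvar p `[a, b[ (fun t => H' t i j) hH.

Let zeta := zeta_bound (p^-1 + q^-1).

Let total_mono W (E : 'I_d -> R -> R) s t : (forall i s t, 0 <= s -> s <= t -> t <= T ->
  incr q (E i) s t <= W i t - W i s) -> 0 <= s -> s <= t -> t <= T ->
  (forall i, 0 <= W i t - W i s <= total W t - total W s).
Proof.
move=> WP s0 st tT i; have W0 k : 0 <= W k t - W k s.
  by apply: le_trans (WP k s t s0 st tT); exact: powR_ge0.
by rewrite W0 /= /total -sumrB (bigD1 i)//= lerDl sumr_ge0.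
Qed.

(** The difference of the integrals is that of [H - H'] against [A] plus that of [H']
    against [A - A']. *)
Lemma young_difference j :
  bvar p `[a, b] (fun t => comp J j t - comp J' j t)
    (2 * (d%:R * (gG + zeta * hG) * (total WA b - total WA a) `^ q^-1 +
          d%:R * (gH + zeta * hH) * (total WE b - total WE a) `^ q^-1)).
Proof.
have p1 := le_trans q1 qp.
have z0 : 0 <= zeta by exact: zeta_bound_ge0.
have q0 : 0 <= q^-1 by rewrite invr_ge0 (le_trans _ q1).
have mono (W E : 'I_d -> R -> R) : (forall i s t, 0 <= s -> s <= t -> t <= T ->
    incr q (E i) s t <= W i t - W i s) ->
    forall s t, a <= s -> s <= t -> t <= b -> total W s <= total W t.
  move=> WP s t as_ st tb; rewrite -subr_ge0 /total -sumrB sumr_ge0// => i _.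
  by have /andP[] := total_mono (E := E) WP (le_trans a0 as_) st (le_trans tb bT) i.
apply: bvar_two_controls => //.
- by rewrite mulr_ge0// addr_ge0// mulr_ge0.
- by rewrite mulr_ge0// addr_ge0// mulr_ge0.
- exact: (mono WA (comp A)).
- exact: (mono WE (fun i t => comp A i t - comp A' i t)).
move=> s t as_; rewrite le_eqVlt => /predU1P[<- _|st tb].
  by rewrite !subrr normr0 addr_ge0// mulr_ge0 ?powR_ge0// mulr_ge0// addr_ge0// mulr_ge0.
have s0 := le_trans a0 as_; have tT := le_trans tb bT.
have t0 := le_trans s0 (ltW st); have sT := le_trans (ltW st) tT.
have sI : s \in `[a, b[ by rewrite in_itv/= as_ (lt_le_trans st).
have sub x : x \in `[a, b] -> 0 <= x <= T.
  by rewrite in_itv/= => /andP[ax xb]; rewrite (le_trans a0)//= (le_trans xb).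
rewrite [X in `|X|](_ : _ = (J t 0 j - J s 0 j) - (J' t 0 j - J' s 0 j)); last by rewrite /comp; ring.
apply: (young_increment_le (H := H) (A := A) (H' := H') (A' := A') s0 (ltW st)).
- by apply: JP; rewrite s0.
- by apply: JP; rewrite t0.
- by apply: JP'; rewrite s0.
- by apply: JP'; rewrite t0.
move=> l pl ll; apply: (le_trans (ler_norm_sum _ _ _)).
rewrite -(mulrA _ (gG + _)) -(mulrA _ (gH + _)) -[d in d%:R]card_ord !mulr_natl -!sumr_const -big_split.
apply: ler_sum => i _ /=; rewrite rs_diff; apply: (le_trans (ler_normD _ _)).
have youngA : `|rs (fun x => H x i j - H' x i j) (comp A i) s l| <=
    (gG + zeta * hG) * (WA i t - WA i s) `^ q^-1.
  have [g1 g2] := GP i j.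
  apply: (le_trans (@young_bvar _ p q a b _ _ (WA i) hG s t l p1 q1 th hG0 g2 _ as_ tb pl ll)).
    move=> x y /sub/andP[x0 _] /sub/andP[_ yT] xy; exact: WAP.
  by apply: ler_wpM2r; [exact: powR_ge0|rewrite lerD2r; exact: g1].
have youngE : `|rs (fun x => H' x i j) (fun x => comp A i x - comp A' i x) s l| <=
    (gH + zeta * hH) * (WE i t - WE i s) `^ q^-1.
  have [g1 g2] := HP' i j.
  apply: (le_trans (@young_bvar _ p q a b _ _ (WE i) hH s t l p1 q1 th hH0 g2 _ as_ tb pl ll)).
    move=> x y /sub/andP[x0 _] /sub/andP[_ yT] xy; exact: WEP.
  by apply: ler_wpM2r; [exact: powR_ge0|rewrite lerD2r; exact: g1].
apply: lerD.
- apply: (le_trans youngA); apply: ler_wpM2l; first by rewrite addr_ge0// mulr_ge0.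
  have /andP[h1 h2] := total_mono (E := comp A) WAP s0 (ltW st) tT i.
  exact: le_powR.
- apply: (le_trans youngE); apply: ler_wpM2l; first by rewrite addr_ge0// mulr_ge0.
  have /andP[h1 h2] := total_mono (E := fun i t => comp A i t - comp A' i t) WEP s0 (ltW st) tT i.
  exact: le_powR.
Qed.

End YoungDifference.

End Assembly.

Section SolutionFacts.
Context {R : realType}.
Variables (n d : nat) (p T : R) (f : 'rV[R]_n -> 'M[R]_(d, n)) (y : 'rV[R]_n).
Variables (A : R -> 'rV[R]_d) (X L Y K : R -> 'rV[R]_n).
Hypothesis sol : is_reflected_solution p T f y A X L Y K.

Lemma solution_young t : 0 <= t <= T ->
  is_young_integral 0 t (f \o Y) A (Y t - y - X t - K t).
Proof.
case: sol => _ _ + _ tT => /(_ t tT)[J hJ ->].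
by rewrite (_ : y + J + X t + K t - y - X t - K t = J)//; apply/rowP => i; rewrite !mxE; ring.
Qed.

Lemma solution_rises i e : 0 < e ->
  rises `[0, T] e (comp K i) (fun t => comp L i t - (comp Y i t - comp K i t)).
Proof.
case: sol => _ _ _ /(_ i)[LY Kmono _ Kflat] e0 s t.
rewrite !in_itv/= => /andP[s0 sT] /andP[t0 tT] st Kst.
have g0 u : 0 <= u <= T -> 0 <= Y u 0 i - L u 0 i by move=> /LY; rewrite subr_ge0.
have [u su hu] := stieltjes_flat_off g0 Kmono Kflat s0 st tT Kst e0.
by exists u => //; rewrite /comp in hu *; lra.
Qed.

Lemma solution_barrier i t : t \in `[0, T] ->
  comp L i t <= comp Y i t - comp K i t + comp K i t.
Proof. by rewrite in_itv/= subrK => tI; case: sol => _ _ _ /(_ i)[LY _ _ _]; exact: LY. Qed.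

Lemma solution_mono i : {in `[0, T] &, {homo comp K i : s t / s <= t}}.
Proof. by case: sol => _ _ _ /(_ i)[]. Qed.

Lemma solution_start : 0 <= T -> Y 0 = y + X 0.
Proof.
move=> T0; have t0 : (0 : R) <= 0 <= T by rewrite lexx.
case: sol => _ _ /(_ 0 t0)[J hJ YE] K0; rewrite YE.
have J0 : J = 0.
  apply/rowP => i; rewrite mxE; apply/eqP; rewrite -normr_le0; apply: le_addeps => e e0.
  rewrite add0r; have [delta _ h] := hJ e e0.
  have := h [::] (conj isT (eqxx _)) (fun k (kl : (k < 0)%N) => False_ind _ (notF kl)).
  rewrite /riemann_sum big_geq// sub0r => /ltW; apply: le_trans.
  by apply: le_trans (coord_le_eucl _ i); rewrite mxE normrN.
have -> : K 0 = 0 by apply/rowP => i; rewrite mxE; case: (K0 i).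
by rewrite J0 !addr0.
Qed.

End SolutionFacts.

Section Coefficients.
Context {R : realType}.
Variables (n d : nat) (f : 'rV[R]_n -> 'M[R]_(d, n)).
Hypothesis fC : is_Cb 2 (@mx_opnorm R d n) f.
Let F := Cb_norm 2 (@mx_opnorm R d n) f.
Let eN := @entry_norm_mx_opnorm R d n.

Let F0 : 0 <= F. Proof. exact: Cb_norm_ge0. Qed.

Lemma coef_bvar p I (Y : R -> 'rV[R]_n) v i j : 1 <= p -> 0 <= v ->
  vbvar p I (comp Y) v -> bvar p I (fun t => f (Y t) i j) (F * n%:R ^+ 2 * v).
Proof.
move=> p1 v0 Yv; rewrite -[n in n%:R]card_ord.
by apply: (bvar_dom (h := comp Y)) => // s t _ _ _; exact: Cb_lipschitz.
Qed.

(** The mean value estimate weights the increments of [Y] and [Y'] by the size [w]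
    of their difference; hence the three families of paths. *)
Lemma coef_diff_bvar p I (Y Y' : R -> 'rV[R]_n) D v w r i j :
  1 <= p -> 0 <= v -> 0 <= w -> 0 <= r ->
  D = (fun i t => comp Y i t - comp Y' i t) ->
  vbvar p I (comp Y) r -> vbvar p I (comp Y') r -> vbvar p I D v -> v <= w ->
  (forall t, t \in I -> vnorm D t <= w) ->
  bvar p I (fun t => f (Y t) i j - f (Y' t) i j)
    (F * (n + (n + n))%:R ^+ 2 * (w * (r + 1))).
Proof.
move=> p1 v0 w0 r0 DE Yr Yr' Dv vw Dw.
pose h (k : 'I_n + ('I_n + 'I_n)) : R -> R := match k with
  | inl k => D k | inr (inl k) => fun t => w * comp Y k t
  | inr (inr k) => fun t => w * comp Y' k t end.
have -> : (n + (n + n))%N = #|{: 'I_n + ('I_n + 'I_n)}| by rewrite !card_sum !card_ord.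
have p0 : 0 <= p by apply: le_trans p1.
apply: (bvar_dom (h := h)) => //; first by rewrite mulr_ge0// addr_ge0.
  move=> s t sI tI st.
  apply: (le_trans (Cb2_increment (Y t) (Y' t) (Y s) (Y' s) i j eN fC)).
  rewrite ler_wpM2l// !big_sumType /= ; apply: lerD.
    by apply: ler_sum => k _; rewrite !subr_mx_entry DE /comp le_eqVlt; apply/orP; left; apply/eqP; congr `|_|; ring.
  apply: (@le_trans _ _ ((dist1 (Y t) (Y s) + dist1 (Y' t) (Y' s)) * w)).
    apply: ler_wpM2l; first by rewrite addr_ge0// dist1_ge0.
    by apply: le_trans (Dw s sI); rewrite DE.
  rewrite mulrDl mulrC [_ * w in X in _ + X]mulrC /dist1 !mulr_sumr.
  by apply: lerD; apply: ler_sum => k _; rewrite -mulrBr normrM (ger0_norm w0).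
have r1 : r <= r + 1 by rewrite lerDl.
have wr : w * r <= w * (r + 1) by apply: ler_wpM2l.
case=> [k|[k|k]] /=.
- by apply: bvar_le (Dv k) => //; apply: (le_trans vw); rewrite ler_peMr// lerDr.
- apply: (bvar_le (v := w * r)) => //; first by rewrite mulr_ge0.
  by apply: bvar_dom1 (Yr k) => // s t _ _ _; rewrite -mulrBr normrM ger0_norm.
- apply: (bvar_le (v := w * r)) => //; first by rewrite mulr_ge0.
  by apply: bvar_dom1 (Yr' k) => // s t _ _ _; rewrite -mulrBr normrM ger0_norm.
Qed.

End Coefficients.

Section Stability.
Context {R : realType}.
Variables (n d : nat) (p q M F : R).
Hypotheses (n0 : (0 < n)%N) (q1 : 1 <= q) (qp : q <= p) (th : 1 < p^-1 + q^-1).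
Hypotheses (M0 : 0 <= M) (F0 : 0 <= F).

Let zeta := zeta_bound (p^-1 + q^-1).
Let Mr := (d%:R * M `^ q) `^ q^-1.

Let z0 : 0 <= zeta. Proof. exact: zeta_bound_ge0. Qed.
Let p1 : 1 <= p. Proof. exact: le_trans qp. Qed.
Let q0 : 0 < q. Proof. exact: lt_le_trans q1. Qed.
Let p0 : 0 < p. Proof. exact: lt_le_trans p1. Qed.
Let Mr0 : 0 <= Mr. Proof. exact: powR_ge0. Qed.

Let total_mono (W : 'I_d -> R -> R) (E : 'I_d -> R -> R) T :
  (forall i s t, 0 <= s -> s <= t -> t <= T -> incr q (E i) s t <= W i t - W i s) ->
  forall s t, 0 <= s -> s <= t -> t <= T -> total W s <= total W t.
Proof.
move=> WP s t s0 st tT; apply: ler_sum => i _; rewrite -subr_ge0.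
by apply: le_trans (WP i s t s0 st tT); exact: powR_ge0.
Qed.

Let total_le (W : 'I_d -> R -> R) c T :
  (forall i t, 0 <= t -> t <= T -> 0 <= W i t <= c) ->
  forall s t, 0 <= s -> s <= t -> t <= T -> total W t - total W s <= d%:R * c.
Proof.
move=> WP s t s0 st tT; rewrite /total -sumrB -[d in d%:R]card_ord mulr_natl -sumr_const.
apply: ler_sum => i _; have /andP[_ h] := WP i t (le_trans s0 st) tT.
have /andP[h' _] := WP i s s0 (le_trans st tT); lra.
Qed.

Let sub_itv a b T (x : R) : 0 <= a -> b <= T -> x \in `[a, b] -> x \in `[0, T].
Proof.
by move=> a0 bT; rewrite !in_itv/= => /andP[ax xb]; rewrite (le_trans a0)//= (le_trans xb).
Qed.

Let rises_sub I J (e : R) (k x : R -> R) : {subset I <= J} -> rises J e k x -> rises I e k x.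
Proof. by move=> IJ H s t /IJ sI /IJ tI; exact: H. Qed.

Let C0 := 512 * (M + 2 * (d%:R * F * Mr) + 2 * (d%:R * (zeta * (F * n%:R ^+ 2)))).

(** [K] is compared with its value frozen at time [a], and likewise for the level, so
    that the initial gap in [reflected_scalar] vanishes. *)
Lemma apriori_step (T : R) (f : 'rV[R]_n -> 'M[R]_(d, n)) y A X L Y K WA a b v :
  is_Cb 2 (@mx_opnorm R d n) f -> Cb_norm 2 (@mx_opnorm R d n) f = F ->
  is_reflected_solution p T f y A X L Y K ->
  vbvar p `[0, T] (comp X) M -> vbvar p `[0, T] (comp L) M ->
  (forall i s t, 0 <= s -> s <= t -> t <= T -> incr q (comp A i) s t <= WA i t - WA i s) ->
  (forall i t, 0 <= t -> t <= T -> 0 <= WA i t <= M `^ q) ->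
  0 <= a -> a <= b -> b <= T -> 0 <= v -> vbvar p `[a, b[ (comp Y) v ->
  vbvar p `[a, b] (comp Y)
    (C0 * (0 * vnorm (comp Y) a + 1) + C0 * v * (total WA b - total WA a) `^ q^-1).
Proof.
move=> fC fF sol XM LM WAP WAM a0 ab bT v0 Yv i.
have eN := @entry_norm_mx_opnorm R d n.
set Om := (_ - _) `^ _; have Om0 : 0 <= Om by exact: powR_ge0.
have OmM : Om <= Mr.
  apply: le_powR; rewrite ?invr_ge0 ?(ltW q0)// ?subr_ge0.
    exact: (total_mono (E := comp A) WAP).
  exact: total_le WAM _ _ _ _ _.
have sub := @sub_itv a b T _ a0 bT.
have hG0 : 0 <= F * n%:R ^+ 2 * v by rewrite !mulr_ge0.
pose J t := Y t - y - X t - K t.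
have YJ : bvar p `[a, b] (fun t => comp J i t - comp (fun=> 0 : 'rV[R]_n) i t)
    (2 * (d%:R * (F + zeta * (F * n%:R ^+ 2 * v)) * Om)).
  have := @young_difference R n d p q T a b q1 qp th a0 bT (f \o Y) (fun=> 0) A A J
    (fun=> 0) WA (fun _ _ => 0) F (F * n%:R ^+ 2 * v) 0 0 hG0 (lexx 0) F0 (lexx 0) WAP.
  rewrite mulr0 addr0 mulr0 mul0r addr0; apply.
  - by move=> j s t _ _ _; rewrite /incr !subrr normr0 powR0// gt_eqF.
  - by move=> t tT; exact: solution_young sol _ tT.
  - by move=> t _; exact: young_integral0.
  - move=> k j; split.
      by move=> t _; rewrite mxE subr0 -fF; exact: Cb_entry_le.
    apply: (@bvar_ext _ _ _ _ (fun t => f (Y t) k j)).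
      by move=> s t _ _ _; rewrite mxE !subr0.
    by rewrite -fF; exact: coef_bvar.
  - move=> k j; split=> [t _|]; first by rewrite mxE normr0.
    apply: (@bvar_ext _ _ _ _ (fun=> 0)) => [s t _ _ _|]; first by rewrite mxE.
    by apply: bvar_cst; rewrite gt_eqF.
set VJ := 2 * _ in YJ; have VJ0 : 0 <= VJ by rewrite !mulr_ge0// addr_ge0// mulr_ge0.
pose V1 := M + VJ; have V10 : 0 <= V1 by rewrite addr_ge0.
have bu : bvar p `[a, b] (fun t => (comp Y i t - comp K i t) - (comp Y i a - comp K i a)) (4 * V1).
  have XM' : bvar p `[a, b] (comp X i) V1.
    apply: (bvar_le (v := M)); rewrite ?(ltW p0)// ?lerDl//.
    by apply: bvar_sub (XM i) => x; exact: sub.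
  have YJ' : bvar p `[a, b] (fun t => comp J i t - comp (fun=> 0 : 'rV[R]_n) i t) V1.
    by apply: bvar_le YJ; rewrite ?(ltW p0)// lerDr.
  apply: (bvar_dom2 p1 V10 _ YJ' XM') => s t _ _ _; apply: le_trans (ler_normD _ _).
  by rewrite le_eqVlt; apply/orP; left; apply/eqP; congr `|_|; rewrite /comp /J !mxE; ring.
have bL : bvar p `[a, b] (fun t => comp L i t - comp L i a) (4 * V1).
  apply: (bvar_ext (h := comp L i)) => [s t _ _ _|]; first by ring.
  apply: (bvar_le (v := M)); rewrite ?(ltW p0)//; first by apply: (@le_trans _ _ V1); [rewrite lerDl|rewrite ler_peMl// ler1n].
  by apply: bvar_sub (LM i) => x; exact: sub.
have ka0 : forall e, rises `[a, b] e (fun=> comp K i a) (fun=> comp L i a - (comp Y i a - comp K i a)).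
  by move=> e s t _ _ _; rewrite ltxx.
have aI : a \in `[a, b] by rewrite in_itv/= lexx.
have mK : {in `[a, b] &, {homo comp K i : s t / s <= t}}.
  by move=> s t sI tI; apply: (solution_mono sol); exact: sub.
have V40 : 0 <= 4 * V1 by rewrite mulr_ge0.
have [//||||||_] := @reflected_scalar R p a b (4 * V1) (fun t => comp Y i t - comp K i t)
  (fun=> comp Y i a - comp K i a) (comp L i) (fun=> comp L i a) (comp K i) (fun=> comp K i a)
  p1 V40 mK _ _ _ _ _ _ bu bL.
- by move=> t /sub; exact: (solution_barrier sol).
- by move=> t _; exact: (solution_barrier sol i (sub a aI)).
- by move=> e e0; apply: (rises_sub sub); exact: (solution_rises sol).
- by move=> e _; exact: ka0.
- by rewrite subrr normr0 !mulr_ge0.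
move=> bY; apply: (bvar_le (v := 128 * (4 * V1))); rewrite ?(ltW p0)// ?mulr_ge0//; last first.
  by apply: bvar_ext bY => s t _ _ _; ring.
have h : d%:R * F * Om <= d%:R * F * Mr by apply: ler_wpM2l => //; rewrite mulr_ge0.
have e1 : 0 <= zeta * (F * n%:R ^+ 2) by apply: mulr_ge0 => //; exact: mulr_ge0.
have e2 : 0 <= (M + 2 * (d%:R * F * Mr)) * (v * Om).
  apply: mulr_ge0; last exact: mulr_ge0.
  by apply: addr_ge0 => //; rewrite !mulr_ge0.
have e3 : 0 <= d%:R * (zeta * (F * n%:R ^+ 2)) by exact: mulr_ge0.
rewrite /V1 /VJ /C0; lra.
Qed.

(** The bound does not see the starting point, since [f] is bounded: [propagation_bound]
    is used with [lam = 0]. *)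
Lemma apriori_bound : exists2 r : R, 0 <= r &
  forall (T : R) (f : 'rV[R]_n -> 'M[R]_(d, n)) y A X L Y K, 0 <= T ->
  is_Cb 2 (@mx_opnorm R d n) f -> Cb_norm 2 (@mx_opnorm R d n) f = F ->
  is_reflected_solution p T f y A X L Y K ->
  vbvar q `[0, T] (comp A) M -> vbvar p `[0, T] (comp X) M ->
  vbvar p `[0, T] (comp L) M -> vbvar p `[0, T] (comp Y) r.
Proof.
have C00 : 0 <= C0.
  apply: mulr_ge0; first exact: ler0n.
  apply: addr_ge0; first by apply: addr_ge0 => //; apply: mulr_ge0 => //; apply: mulr_ge0 => //; exact: mulr_ge0.
  by apply: mulr_ge0 => //; apply: mulr_ge0 => //; apply: mulr_ge0 => //; exact: mulr_ge0.
have Mw0 : 0 <= d%:R * M `^ q by rewrite mulr_ge0// powR_ge0.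
have r0 : 0 < q^-1 by rewrite invr_gt0.
have [C Cge HC] := @propagation_bound R 'I_n p q^-1 p1 r0 C0 0 _ C00 (lexx 0) Mw0.
exists C => // T f y A X L Y K T0 fC fF sol AM XM LM.
have [WA [WAP WAM]] := controls_exist M0 AM.
have := HC T 1 (comp Y) (total WA) T0 ler01.
rewrite mul0r add0r mulr1; apply.
- exact: (total_mono (E := comp A) WAP).
- exact: total_le WAM.
- by move=> c; apply: cadlag_right_cont; case: sol => -[].
- have [_ /rvar_finP[v v0 vE]] : Dspace p T Y by case: sol.
  by exists v => //; apply: rvar_bvar => //; rewrite vE.
- by move=> a b v a0 ab bT v0 Yv; exact: (apriori_step fC fF sol XM LM WAP WAM a0 ab bT v0 Yv).
Qed.

Section Difference.
Variable r : R.
Hypothesis r0 : 0 <= r.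

Let c1 := 2 * (d%:R * (F + zeta * (F * (n + (n + n))%:R ^+ 2 * (r + 1)))).
Let c2 := 2 * (d%:R * (F + zeta * (F * n%:R ^+ 2 * r)) * d%:R `^ q^-1).
Let C1 := 512 * (c1 * Mr + c2 + 1 + c1 * n%:R).

Let c10 : 0 <= c1.
Proof.
apply: mulr_ge0 => //; apply: mulr_ge0 => //; apply: addr_ge0 => //.
apply: mulr_ge0 => //; apply: mulr_ge0; first exact: mulr_ge0.
exact: addr_ge0.
Qed.

Let c20 : 0 <= c2.
Proof.
apply: mulr_ge0 => //; apply: mulr_ge0; last exact: powR_ge0.
apply: mulr_ge0 => //; apply: addr_ge0 => //.
by apply: mulr_ge0 => //; apply: mulr_ge0 => //; exact: mulr_ge0.
Qed.

Let C10 : 0 <= C1.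
Proof.
apply: mulr_ge0; first exact: ler0n.
apply: addr_ge0; last exact: mulr_ge0.
by apply: addr_ge0 => //; apply: addr_ge0 => //; exact: mulr_ge0.
Qed.

Section Data.
Variables (T B : R) (f : 'rV[R]_n -> 'M[R]_(d, n)) (y y' : 'rV[R]_n).
Variables (A A' : R -> 'rV[R]_d) (X X' L L' Y K Y' K' : R -> 'rV[R]_n).
Hypotheses (T0 : 0 <= T) (B0 : 0 <= B).
Hypothesis fC : is_Cb 2 (@mx_opnorm R d n) f.
Hypothesis fF : Cb_norm 2 (@mx_opnorm R d n) f = F.
Hypothesis sol : is_reflected_solution p T f y A X L Y K.
Hypothesis sol' : is_reflected_solution p T f y' A' X' L' Y' K'.
Hypothesis AM : vbvar q `[0, T] (comp A) M.
Hypotheses (Yr : vbvar p `[0, T] (comp Y) r) (Yr' : vbvar p `[0, T] (comp Y') r).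
Hypothesis AB : vbvar q `[0, T] (fun i t => comp A i t - comp A' i t) B.
Hypothesis XB : vbvar p `[0, T] (fun i t => comp X i t - comp X' i t) B.
Hypothesis LB : vbvar p `[0, T] (fun i t => comp L i t - comp L' i t) B.
Hypothesis L0B : forall i, `|comp L i 0 - comp L' i 0| <= B.

Let D (i : 'I_n) (t : R) := comp Y i t - comp Y' i t.

Lemma difference_step (WA : 'I_d -> R -> R) a b v :
  (forall i s t, 0 <= s -> s <= t -> t <= T -> incr q (comp A i) s t <= WA i t - WA i s) ->
  (forall i t, 0 <= t -> t <= T -> 0 <= WA i t <= M `^ q) ->
  0 <= a -> a <= b -> b <= T -> 0 <= v -> vbvar p `[a, b[ D v ->
  let w := C1 * (1 * vnorm D a + B) + C1 * v * (total WA b - total WA a) `^ q^-1 in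
  vbvar p `[a, b] D w /\ vbvar p `[a, b] (fun i t => comp K i t - comp K' i t) w.
Proof.
move=> WAP WAM a0 ab bT v0 Dv w.
have eN := @entry_norm_mx_opnorm R d n.
rewrite /w; set Om := (_ - _) `^ _; set N := vnorm D a.
have Om0 : 0 <= Om by exact: powR_ge0.
have N0 : 0 <= N by exact: vnorm_ge0.
have OmM : Om <= Mr.
  apply: le_powR; rewrite ?invr_ge0 ?(ltW q0)// ?subr_ge0.
    exact: (total_mono (E := comp A) WAP).
  exact: total_le WAM _ _ _ _ _.
have sub := @sub_itv a b T _ a0 bT.
have subo t : t \in `[a, b[ -> t \in `[0, T].
  by rewrite in_itv/= => /andP[at_ tb]; apply: sub; rewrite in_itv/= at_ ltW.
pose E := N + n%:R * v; have nv0 : 0 <= n%:R * v by rewrite mulr_ge0.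
have E0 : 0 <= E by rewrite addr_ge0.
have vE : v <= E by apply: (@le_trans _ _ (n%:R * v)); rewrite ?lerDr// ler_peMl// ler1n.
have DE t : t \in `[a, b[ -> vnorm D t <= E.
  move=> tI; have aI : a \in `[a, b[.
    by move: tI; rewrite !in_itv/= lexx => /andP[at_ tb]; exact: le_lt_trans tb.
  by have := vnorm_le p1 v0 Dv aI tI; rewrite card_ord.
pose hG := F * (n + (n + n))%:R ^+ 2 * (E * (r + 1)).
have hG0 : 0 <= hG by rewrite !mulr_ge0// addr_ge0.
have hH0 : 0 <= F * n%:R ^+ 2 * r by rewrite !mulr_ge0.
have [WE [WEP WEM]] : exists WE : 'I_d -> R -> R,
    (forall i s t, 0 <= s -> s <= t -> t <= T ->
       incr q (fun t => comp A i t - comp A' i t) s t <= WE i t - WE i s) /\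
    (forall i t, 0 <= t -> t <= T -> 0 <= WE i t <= B `^ q).
  have AB' : vbvar q `[0, T] (comp (A \- A')) B.
    by move=> i; apply: bvar_ext (AB i) => s t _ _ _; rewrite /comp !subr_mx_entry.
  have [WE [h1 h2]] := controls_exist B0 AB'; exists WE; split=> // i s t s0 st tT.
  by apply: le_trans (h1 i s t s0 st tT); rewrite /incr /comp !subr_mx_entry.
pose J t := Y t - y - X t - K t; pose J' t := Y' t - y' - X' t - K' t.
have JB i : bvar p `[a, b] (fun t => comp J i t - comp J' i t) (c1 * E * Om + c2 * B).
  have := @young_difference R n d p q T a b q1 qp th a0 bT (f \o Y) (f \o Y') A A' J J'
    WA WE (F * E) hG F (F * n%:R ^+ 2 * r) hG0 hH0 (mulr_ge0 F0 E0) F0 WAP WEP.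
  move=> H; apply: (bvar_le _ _ _ (H _ _ _ _ i)); first exact: ltW.
  - have h1 : 0 <= F * E + zeta * hG by apply: addr_ge0; exact: mulr_ge0.
    have h2 : 0 <= F + zeta * (F * n%:R ^+ 2 * r) by apply: addr_ge0 => //; exact: mulr_ge0.
    apply: mulr_ge0 => //; apply: addr_ge0; apply: mulr_ge0; rewrite ?powR_ge0//; exact: mulr_ge0.
  - have OE : (total WE b - total WE a) `^ q^-1 <= d%:R `^ q^-1 * B.
      have -> : d%:R `^ q^-1 * B = (d%:R * B `^ q) `^ q^-1.
        by rewrite powRM ?powR_ge0// powRK// gt_eqF.
      apply: le_powR; first by rewrite invr_ge0 ltW.
        rewrite subr_ge0.
        exact: (total_mono (E := fun i t => comp A i t - comp A' i t) WEP).
      exact: total_le WEM _ _ _ _ _.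
    rewrite [leLHS]mulrDr; apply: lerD.
      rewrite -/zeta le_eqVlt -/Om /c1 /hG; apply/orP; left; apply/eqP; ring.
    rewrite -/zeta (_ : c2 * B = 2 * (d%:R * (F + zeta * (F * n%:R ^+ 2 * r)) * (d%:R `^ q^-1 * B))).
      apply: ler_wpM2l => //; apply: ler_wpM2l OE.
      by apply: mulr_ge0 => //; apply: addr_ge0 => //; exact: mulr_ge0.
    by rewrite /c2; ring.
  - by move=> t tT; exact: solution_young sol _ tT.
  - by move=> t tT; exact: solution_young sol' _ tT.
  - move=> k j; split.
      move=> t tI; rewrite -fF; apply: (le_trans (Cb_lipschitz eN _ _ _ _ fC)).
      by rewrite fF; apply: ler_wpM2l => //; exact: DE.
    rewrite /hG -fF; apply: (coef_diff_bvar fC _ _ p1 v0 E0 r0 (erefl D)) => //.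
    + by move=> k'; apply: bvar_sub (Yr k').
    + by move=> k'; apply: bvar_sub (Yr' k').
  - move=> k j; split; first by move=> t _; rewrite -fF; exact: Cb_entry_le.
    by rewrite -fF; apply: coef_bvar => // k'; apply: bvar_sub (Yr' k').
set VJ := c1 * E * Om + c2 * B in JB.
have VJ0 : 0 <= VJ.
  by apply: addr_ge0; [apply: mulr_ge0 => //; exact: mulr_ge0|exact: mulr_ge0].
have BN0 : 0 <= B + N by exact: addr_ge0.
pose V1 := VJ + (B + N); have V10 : 0 <= V1 by exact: addr_ge0.
have BV : B <= V1 by apply: (@le_trans _ _ (B + N)); rewrite ?lerDl ?lerDr.
have V40 : 0 <= 4 * V1 by rewrite mulr_ge0.
have BV4 : B <= 4 * V1 by apply: (le_trans BV); rewrite ler_peMl// ler1n.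
have aI : a \in `[a, b] by rewrite in_itv/= lexx.
have bL i : bvar p `[a, b] (fun t => comp L i t - comp L' i t) (4 * V1).
  by apply: (bvar_le (v := B)); rewrite ?(ltW p0)//; apply: bvar_sub (LB i) => x; exact: sub.
have bu i : bvar p `[a, b] (fun t => (comp Y i t - comp K i t) - (comp Y' i t - comp K' i t)) (4 * V1).
  have bX : bvar p `[a, b] (fun t => comp X i t - comp X' i t) V1.
    by apply: (bvar_le (v := B)); rewrite ?(ltW p0)//; apply: bvar_sub (XB i) => x; exact: sub.
  have bJ : bvar p `[a, b] (fun t => comp J i t - comp J' i t) V1.
    by apply: bvar_le (JB i); rewrite ?(ltW p0)// lerDl.
  apply: (bvar_dom2 p1 V10 _ bJ bX) => s t _ _ _; apply: le_trans (ler_normD _ _).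
  by rewrite le_eqVlt; apply/orP; left; apply/eqP; congr `|_|; rewrite /comp /J /J' !mxE; ring.
have init i : `|(comp L i a - (comp Y i a - comp K i a + comp K i a)) -
    (comp L' i a - (comp Y' i a - comp K' i a + comp K' i a))| <= 4 * (4 * V1).
  have La : `|comp L i a - comp L' i a| <= B + B.
    have zI : (0 : R) \in `[0, T] by rewrite in_itv/= lexx.
    have := bvar_incr p0 B0 (LB i) zI (sub a aI).
    by move: (L0B i) => h1 h2; have := le_trans (ler_normD _ _) (lerD h2 h1); rewrite subrK.
  have Da : `|D i a| <= N by rewrite /N /vnorm (bigD1 i)//= lerDl sumr_ge0.
  rewrite [X in `|X|](_ : _ = (comp L i a - comp L' i a) - D i a); last by rewrite /D; ring.
  apply: (le_trans (ler_normB _ _)); apply: (le_trans (lerD La Da)).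
  by move: VJ0 B0 N0; rewrite /V1; lra.
have mK i : {in `[a, b] &, {homo comp K i : s t / s <= t}}.
  by move=> s t sI tI; apply: (solution_mono sol); exact: sub.
have mK' i : {in `[a, b] &, {homo comp K' i : s t / s <= t}}.
  by move=> s t sI tI; apply: (solution_mono sol'); exact: sub.
have main i : bvar p `[a, b] (fun t => comp K i t - comp K' i t) (512 * V1) /\
    bvar p `[a, b] (D i) (512 * V1).
  rewrite (_ : 512 * V1 = 128 * (4 * V1)); last by ring.
  have [||||b1 b2] := @reflected_scalar R p a b (4 * V1) (fun t => comp Y i t - comp K i t)
    (fun t => comp Y' i t - comp K' i t) (comp L i) (comp L' i) (comp K i) (comp K' i)
    p1 V40 (mK i) (mK' i) _ _ _ _ (init i) (bu i) (bL i).
  - by move=> t /sub; exact: (solution_barrier sol).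
  - by move=> t /sub; exact: (solution_barrier sol').
  - by move=> e e0; apply: (rises_sub sub); exact: (solution_rises sol).
  - by move=> e e0; apply: (rises_sub sub); exact: (solution_rises sol').
  split => //; apply: bvar_ext b2 => s t _ _ _; rewrite /D; ring.
have wV : 512 * V1 <= C1 * (1 * N + B) + C1 * v * Om.
  have h1 : c1 * N * Om <= c1 * N * Mr by apply: ler_wpM2l => //; exact: mulr_ge0.
  have h2 : 0 <= c1 * Mr * B by apply: mulr_ge0 => //; exact: mulr_ge0.
  have h3 : 0 <= c1 * n%:R * (N + B).
    by apply: mulr_ge0; [exact: mulr_ge0|exact: addr_ge0].
  have h4 : 0 <= c2 * N by exact: mulr_ge0.
  have h5 : 0 <= (c1 * Mr + c2 + 1) * (v * Om).
    apply: mulr_ge0; last exact: mulr_ge0.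
    by apply: addr_ge0 => //; apply: addr_ge0 => //; exact: mulr_ge0.
  rewrite /V1 /VJ /E /C1; lra.
have V512 : 0 <= 512 * V1 by apply: mulr_ge0; first exact: ler0n.
by split=> i; [apply: bvar_le (main i).2|apply: bvar_le (main i).1]; rewrite ?(ltW p0).
Qed.

End Data.
(** The reflection terms are estimated at the end, by [difference_step] on the whole
    interval, where the variation of [Y - Y'] is already known. *)
Lemma difference_bound : exists2 C : R, 0 <= C &
  forall (T B : R) (f : 'rV[R]_n -> 'M[R]_(d, n)) y y' A A' X X' L L' Y K Y' K',
  0 <= T -> 0 <= B -> is_Cb 2 (@mx_opnorm R d n) f ->
  Cb_norm 2 (@mx_opnorm R d n) f = F ->
  is_reflected_solution p T f y A X L Y K ->
  is_reflected_solution p T f y' A' X' L' Y' K' ->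
  vbvar q `[0, T] (comp A) M ->
  vbvar p `[0, T] (comp Y) r -> vbvar p `[0, T] (comp Y') r ->
  vbvar q `[0, T] (fun i t => comp A i t - comp A' i t) B ->
  vbvar p `[0, T] (fun i t => comp X i t - comp X' i t) B ->
  vbvar p `[0, T] (fun i t => comp L i t - comp L' i t) B ->
  (forall i, `|comp L i 0 - comp L' i 0| <= B) ->
  (forall i, `|y 0 i - y' 0 i| <= B) -> X 0 = X' 0 ->
  vbvar p `[0, T] (fun i t => comp Y i t - comp Y' i t) (C * B) /\
  vbvar p `[0, T] (fun i t => comp K i t - comp K' i t) (C * B).
Proof.
have Mw0 : 0 <= d%:R * M `^ q by apply: mulr_ge0 => //; exact: powR_ge0.
have iq0 : 0 < q^-1 by rewrite invr_gt0.
have [C Cge HC] := @propagation_bound R 'I_n p q^-1 p1 iq0 C1 1 _ C10 ler01 Mw0.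
have n1 : 0 <= n%:R + 1 :> R by apply: addr_ge0.
exists (C1 * (n%:R + 1) + C1 * (C * (n%:R + 1)) * Mr).
  by apply: addr_ge0; [exact: mulr_ge0|apply: mulr_ge0 => //; apply: mulr_ge0 => //; exact: mulr_ge0].
move=> T B f y y' A A' X X' L L' Y K Y' K' T0 B0 fC fF sol sol' AM Yr Yr' AB XB LB L0B yB XX.
pose D (i : 'I_n) t := comp Y i t - comp Y' i t.
have [WA [WAP WAM]] := controls_exist M0 AM.
have Omono := total_mono (E := comp A) WAP.
have N0 : vnorm D 0 <= n%:R * B.
  rewrite /vnorm -[n in n%:R]card_ord mulr_natl -sumr_const; apply: ler_sum => i _.
  rewrite /D /comp (solution_start sol T0) (solution_start sol' T0) XX !mxE.
  by rewrite [X in `|X|](_ : _ = y 0 i - y' 0 i); [exact: yB|ring].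
have Dv : vbvar p `[0, T] D (C * (1 * vnorm D 0 + B)).
  apply: (HC T B D (total WA)) => //.
  - exact: total_le WAM.
  - move=> c cT e e0; have e2 : 0 < e / 2 by rewrite divr_gt0.
    have cY : cadlag T Y by case: sol => -[].
    have cY' : cadlag T Y' by case: sol' => -[].
    have [d1 cd1 h1] := cadlag_right_cont cY cT e2.
    have [d2 cd2 h2] := cadlag_right_cont cY' cT e2.
    exists (Num.min d1 d2); first by rewrite lt_min cd1.
    move=> k x /andP[cx]; rewrite le_min => /andP[x1 x2].
    have k1 := h1 k x ltac:(by rewrite cx); have k2 := h2 k x ltac:(by rewrite cx).
    rewrite [X in `|X|](_ : _ = (comp Y k x - comp Y k c) - (comp Y' k x - comp Y' k c)); last by rewrite /D; ring.
    by apply: (le_trans (ler_normB _ _)); lra.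
  - exists (4 * r); first by rewrite mulr_ge0.
    move=> i; apply: (bvar_dom2 p1 r0 _ (Yr i) (Yr' i)) => s t _ _ _.
    rewrite [X in `|X|](_ : _ = (comp Y i t - comp Y i s) - (comp Y' i t - comp Y' i s)); last by rewrite /D; ring.
    exact: ler_normB.
  - move=> a b v a0 ab bT v0 Dv.
    by have [] := difference_step T0 B0 fC fF sol sol' Yr Yr' AB XB LB L0B WAP WAM a0 ab bT v0 Dv.
have v0 : 0 <= C * ((n%:R + 1) * B) by apply: mulr_ge0 => //; exact: mulr_ge0.
have Dv' : vbvar p `[0, T[ D (C * ((n%:R + 1) * B)).
  move=> i; apply: bvar_le (bvar_sub _ (Dv i)).
  - exact: ltW.
  - by apply: mulr_ge0 => //; apply: addr_ge0 => //; rewrite mul1r vnorm_ge0.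
  - by apply: ler_wpM2l => //; lra.
  - by move=> x; rewrite !in_itv/= => /andP[-> /ltW].
have := difference_step T0 B0 fC fF sol sol' Yr Yr' AB XB LB L0B WAP WAM (lexx 0) T0 (lexx T) v0 Dv'.
set w := _ + _; have w0 : 0 <= w.
  apply: addr_ge0; last by apply: mulr_ge0; [exact: mulr_ge0|exact: powR_ge0].
  by apply: mulr_ge0 => //; apply: addr_ge0 => //; rewrite mul1r vnorm_ge0.
have wle : w <= (C1 * (n%:R + 1) + C1 * (C * (n%:R + 1)) * Mr) * B.
  rewrite mulrDl; apply: lerD.
    by rewrite -mulrA; apply: ler_wpM2l => //; lra.
  rewrite (_ : _ * Mr * B = C1 * (C * ((n%:R + 1) * B)) * Mr); last by ring.
  apply: ler_wpM2l; first exact: mulr_ge0.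
  apply: le_powR; first exact: ltW.
    by rewrite subr_ge0; exact: Omono.
  exact: total_le WAM _ _ _ _ _.
by move=> [hD hK]; split=> i; [apply: bvar_le (hD i)|apply: bvar_le (hK i)]; rewrite ?(ltW p0).
Qed.

End Difference.

End Stability.

(** * The stability constant *)

Section StabilityConstant.
Context {R : realType}.
Variables (n d : nat) (p q : R).

(** Isolated because the constant must be chosen as a function of [M] and of the norm
    [F] of the coefficient before any other datum is given. *)
Definition stability_constant (M F C : R) : Prop := 0 <= C /\
  forall (T B : R) (f : 'rV[R]_n -> 'M[R]_(d, n)) y y' A A' X X' L L' Y K Y' K',
  0 <= T -> 0 <= B -> is_Cb 2 (@mx_opnorm R d n) f ->
  Cb_norm 2 (@mx_opnorm R d n) f = F ->
  is_reflected_solution p T f y A X L Y K ->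
  is_reflected_solution p T f y' A' X' L' Y' K' ->
  vbvar q `[0, T] (comp A) M -> vbvar q `[0, T] (comp A') M ->
  vbvar p `[0, T] (comp X) M -> vbvar p `[0, T] (comp X') M ->
  vbvar p `[0, T] (comp L) M -> vbvar p `[0, T] (comp L') M ->
  vbvar q `[0, T] (comp (A \- A')) B ->
  vbvar p `[0, T] (comp (X \- X')) B ->
  vbvar p `[0, T] (comp (L \- L')) B ->
  eucl (L 0 - L' 0) <= B -> eucl (y - y') <= B -> X 0 = X' 0 ->
  vbvar p `[0, T] (comp (Y \- Y')) (C * B) /\
  vbvar p `[0, T] (comp (K \- K')) (C * B).

Let vbvar_sub k r (Z Z' : R -> 'rV[R]_k) T v : vbvar r `[0, T] (comp (Z \- Z')) v ->
  vbvar r `[0, T] (fun i t => comp Z i t - comp Z' i t) v.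
Proof.
by move=> h i; apply: bvar_ext (h i) => s t _ _ _; rewrite /comp !subr_mx_entry.
Qed.

Let vbvar_sub' k r (Z Z' : R -> 'rV[R]_k) T v :
  vbvar r `[0, T] (fun i t => comp Z i t - comp Z' i t) v ->
  vbvar r `[0, T] (comp (Z \- Z')) v.
Proof.
by move=> h i; apply: bvar_ext (h i) => s t _ _ _; rewrite /comp !subr_mx_entry.
Qed.

Lemma stability_constant_exists (M F : R) : (0 < n)%N -> 1 <= q -> q <= p ->
  1 < p^-1 + q^-1 -> 0 <= M -> 0 <= F -> exists C, stability_constant M F C.
Proof.
move=> n0 q1 qp th M0 F0.
have [r r0 Hr] := @apriori_bound R n d p q M F q1 qp th M0 F0.
have [C C0 HC] := @difference_bound R n d p q M F n0 q1 qp th M0 F0 r r0.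
exists C; split=> // T B f y y' A A' X X' L L' Y K Y' K' T0 B0 fC fF sol sol'.
move=> AM AM' XM XM' LM LM' /vbvar_sub AB /vbvar_sub XB /vbvar_sub LB L0 yB X0.
have [//|//|||//|] := HC T B f y y' A A' X X' L L' Y K Y' K' T0 B0 fC fF sol sol' AM _ _ AB XB LB.
- exact: (Hr T f y A X L Y K).
- exact: (Hr T f y' A' X' L' Y' K').
- by move=> i; rewrite /comp -subr_mx_entry; apply: le_trans (coord_le_eucl _ _) L0.
- by move=> i; rewrite -subr_mx_entry; apply: le_trans (coord_le_eucl _ _) yB.
by move=> h1 h2; split; exact: vbvar_sub'.
Qed.

Lemma rvar_sub_fin k r (T M : R) (Z Z' : R -> 'rV[R]_k) : 1 <= r -> 0 <= T -> 0 <= M ->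
  vbvar r `[0, T] (comp Z) M -> vbvar r `[0, T] (comp Z') M ->
  exists2 v, 0 <= v & rvar r 0 T (Z \- Z') = v%:E.
Proof.
move=> r1 T0 M0 ZM ZM'; apply: rvar_finP.
apply: (@le_lt_trans _ _ (k%:R ^+ 2 * (4 * M))%:E); last exact: ltry.
apply: bvar_rvar => //; first by rewrite mulr_ge0.
move=> i; apply: (bvar_dom2 r1 M0 _ (ZM i) (ZM' i)) => s t _ _ _.
rewrite [X in `|X|](_ : _ = (comp Z i t - comp Z i s) - (comp Z' i t - comp Z' i s)).
  exact: ler_normB.
by rewrite /comp !subr_mx_entry; ring.
Qed.

End StabilityConstant.

Unset Implicit Arguments.
Set Strict Implicit.
Set Printing Implicit Defensive.

Theorem proposition2p9 (R : realType) (n d : nat) (p q : R)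
    (hn : (0 < n)%N) (hd : (0 < d)%N)
    (hq1 : 1 <= q) (hq2 : q < 2) (hqp : q <= p) (hpq : 1 < p^-1 + q^-1) :
  exists C : R -> R -> R,
  forall (T M : R) (f : 'rV[R]_n -> 'M[R]_(d, n))
    (y y' : 'rV[R]_n) (A A' : R -> 'rV[R]_d) (X X' L L' : R -> 'rV[R]_n)
    (Y K Y' K' : R -> 'rV[R]_n),
  0 < T -> 0 < M ->
  is_Cb 2 (@mx_opnorm R d n) f ->
  Dspace q T A -> Dspace q T A' ->
  Dspace p T X -> Dspace p T X' ->
  Dspace p T L -> Dspace p T L' ->
  (forall i : 'I_n, L 0 0 i <= y 0 i) ->
  (forall i : 'I_n, L' 0 0 i <= y' 0 i) ->
  (* the common value is 0 under the normalisation Y_0 = y *)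
  X 0 = X' 0 ->
  is_reflected_solution p T f y A X L Y K ->
  is_reflected_solution p T f y' A' X' L' Y' K' ->
  (rvar q 0 T A <= M%:E)%E -> (rvar q 0 T A' <= M%:E)%E ->
  (rvar p 0 T X <= M%:E)%E -> (rvar p 0 T X' <= M%:E)%E ->
  (rvar p 0 T L <= M%:E)%E -> (rvar p 0 T L' <= M%:E)%E ->
  (rvar p 0 T (Y \- Y') + rvar p 0 T (K \- K') <=
   (C M (Cb_norm 2 (@mx_opnorm R d n) f))%:E *
   ((eucl (y - y'))%:E + rvar q 0 T (A \- A') + rvar p 0 T (X \- X') +
    (eucl (L 0 - L' 0))%:E + rvar p 0 T (L \- L')))%E.
Proof.
have p1 : 1 <= p := le_trans hq1 hqp.
have ex (MF : R * R) : exists C : R, 0 <= MF.1 -> 0 <= MF.2 ->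
    stability_constant n d p q MF.1 MF.2 C.
  case: MF => M F /=; have [M0|M0] := leP 0 M; last by exists 0.
  have [F0|F0] := leP 0 F; last by exists 0.
  have [C HC] := @stability_constant_exists R n d p q M F hn hq1 hqp hpq M0 F0.
  by exists C.
have [g Hg] := choice ex.
exists (fun M F => 2 * (n%:R ^+ 2 * g (M, F))).
move=> T M f y y' A A' X X' L L' Y K Y' K' /ltW T0 /ltW M0 fC _ _ _ _ _ _ _ _ X0 sol sol'.
move=> /(rvar_bvar hq1 M0) AM /(rvar_bvar hq1 M0) AM' /(rvar_bvar p1 M0) XM.
move=> /(rvar_bvar p1 M0) XM' /(rvar_bvar p1 M0) LM /(rvar_bvar p1 M0) LM'.
have F0 := Cb_norm_ge0 (@entry_norm_mx_opnorm R d n) fC.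
have [C0 HC] := Hg (M, _) M0 F0; set C := g _ in C0 HC *.
have [vA vA0 eA] := rvar_sub_fin hq1 T0 M0 AM AM'.
have [vX vX0 eX] := rvar_sub_fin p1 T0 M0 XM XM'.
have [vL vL0 eL] := rvar_sub_fin p1 T0 M0 LM LM'.
rewrite eA eX eL -!EFinD.
set B := eucl _ + vA + vX + _ + vL.
have y0 := eucl_ge0 (y - y'); have L0 := eucl_ge0 (L 0 - L' 0).
have B0 : 0 <= B by rewrite !addr_ge0.
have le_B r k (Z Z' : R -> 'rV[R]_k) v : 1 <= r -> 0 <= v -> v <= B ->
    rvar r 0 T (Z \- Z') = v%:E -> vbvar r `[0, T] (comp (Z \- Z')) B.
  by move=> r1 v0 vB e; apply: rvar_bvar; rewrite // e lee_fin.
have [|||||hY hK] := HC T B f y y' A A' X X' L L' Y K Y' K' T0 B0 fC erefl sol sol'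
  AM AM' XM XM' LM LM' _ _ _ _ _ X0.
- by apply: le_B eA => //; rewrite /B; lra.
- by apply: le_B eX => //; rewrite /B; lra.
- by apply: le_B eL => //; rewrite /B; lra.
- by rewrite /B; lra.
- by rewrite /B; lra.
have CB0 : 0 <= C * B by exact: mulr_ge0.
rewrite -EFinM (_ : 2 * _ * B = n%:R ^+ 2 * (C * B) + n%:R ^+ 2 * (C * B)); last by ring.
rewrite EFinD; apply: leeD; exact: bvar_rvar.
Qed.
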